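(* Let $N\ge 1$, $s\in(0,1)$, $0<\lambda\le\Lambda$. Let $\mathcal{A}$ be a nonempty set, let $L_a\in\mathcal{L}$ for every $a\in\mathcal{A}$, and let $I$ be an operator of the form $Iu(x)=\sup_{a\in\mathcal{A}}L_au(x)$ or of the form $Iu(x)=\inf_{a\in\mathcal{A}}L_au(x)$. Let $V:\mathbb{R}^N\to\mathbb{R}$ be a bounded continuous function. Assume that for each bounded $C^2$ domain $G\subset\mathbb{R}^N$ the operator $F=I+V$ satisfies both the maximum principle in $G$ and the minimum principle in $G$, i.e. $\lambda_1^+(I+V,G)>0$ and $\lambda_1^-(I+V,G)>0$. If $u\in L^1_{\omega_s}(\mathbb{R}^N)$ is a viscosity solution to $Iu+Vu=0$ in $\mathbb{R}^N$ such that $$\lim_{|x|\to\infty}|u(x)|\,|x|^{N+2s}=0,$$ then $u\equiv 0$ in $\mathbb{R}^N$.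
   Context: $\mathcal{L}$ is the class of all operators $Lu(x)=\mathrm{P.V.}\int_{\mathbb{R}^N}(u(x+y)-u(x))K(y)\,dy$ where the measurable kernel $K$ is symmetric, $K(y)=K(-y)$, and $\frac{\lambda}{|y|^{N+2s}}\le K(y)\le\frac{\Lambda}{|y|^{N+2s}}$. $L^1_{\omega_s}(\mathbb{R}^N)$ is the space of measurable functions $u:\mathbb{R}^N\to\mathbb{R}$ with $\|u\|_{L^1_{\omega_s}(\mathbb{R}^N)}:=\int_{\mathbb{R}^N}\frac{|u(x)|}{1+|x|^{N+2s}}\,dx<\infty$. USC and LSC denote upper and lower semicontinuous functions. Viscosity solutions. Let $\Omega\subset\mathbb{R}^N$ be open and $f,V\in C(\Omega)$. A function $u\in \mathrm{USC}(\Omega)\cap L^1_{\omega_s}(\mathbb{R}^N)$ is a viscosity subsolution of $Iu+V(x)u=f$ in $\Omega$, written $Iu+Vu\ge f$, if for any $x\in\Omega$, any neighborhood $N_x$ of $x$ in $\Omega$, and any $\psi\in L^1_{\omega_s}(\mathbb{R}^N)$ with $\psi\in C^2(N_x)$, $\psi(x)=u(x)$ and $\psi\ge u$ in $\mathbb{R}^N$, one has $I\psi(x)+V(x)u(x)\ge f(x)$. A function $u\in \mathrm{LSC}(\Omega)\cap L^1_{\omega_s}(\mathbb{R}^N)$ is a viscosity supersolution, written $Iu+Vu\le f$, if for any $x$, $N_x$ as before and any $\phi\in L^1_{\omega_s}(\mathbb{R}^N)$ with $\phi\in C^2(N_x)$, $\phi(x)=u(x)$ and $\phi\le u$ in $\mathbb{R}^N$,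 one has $I\phi(x)+V(x)u(x)\le f(x)$. A viscosity solution is a function $u\in C(\Omega)\cap L^1_{\omega_s}(\mathbb{R}^N)$ that is both a viscosity subsolution and a viscosity supersolution. Maximum/minimum principle. For $F=I+V$ and a bounded $C^2$ domain $G$: $F$ satisfies the maximum principle in $G$, denoted $\lambda_1^+(F,G)>0$, if every $v\in \mathrm{USC}(\overline G)\cap L^1_{\omega_s}(\mathbb{R}^N)$ with $F[v]\ge0$ in $G$ in the viscosity sense and $v\le0$ in $\mathbb{R}^N\setminus G$ satisfies $v\le0$ in $\mathbb{R}^N$. $F$ satisfies the minimum principle in $G$, denoted $\lambda_1^-(F,G)>0$, if every $v\in \mathrm{LSC}(\overline G)\cap L^1_{\omega_s}(\mathbb{R}^N)$ with $F[v]\le0$ in $G$ in the viscosity sense and $v\ge0$ in $\mathbb{R}^N\setminus G$ satisfies $v\ge0$ in $\mathbb{R}^N$. *)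

(* Defs.v *)
From HB Require Import structures.
From mathcomp Require Import all_boot all_order all_algebra.
From mathcomp Require Import all_classical all_reals all_analysis.
Set Implicit Arguments.
Unset Strict Implicit.
Unset Printing Implicit Defensive.
Import Order.TTheory GRing.Theory Num.Theory.
Import numFieldNormedType.Exports.
Local Open Scope classical_set_scope.
Local Open Scope ring_scope.

Lemma sigma_finite_product d1 d2 (T1 : measurableType d1)
    (T2 : measurableType d2) (R : realType)
    (m1 : {sigma_finite_measure set T1 -> \bar R})
    (m2 : {sigma_finite_measure set T2 -> \bar R}) :
  sigma_finite setT (m1 \x m2)%E.
Proof.
have /sigma_finiteP[F [TF ndF Foo]] := sigma_finiteT m1.
have /sigma_finiteP[G [TG ndG Goo]] := sigma_finiteT m2.
exists (fun n => F n `*` G n).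
  rewrite -setXTT TF TG predeqE => -[x y]; split.
    move=> [/= [n _ Fnx] [k _ Gky]]; exists (maxn n k) => //; split.
    - by move: x Fnx; exact/subsetPset/ndF/leq_maxl.
    - by move: y Gky; exact/subsetPset/ndG/leq_maxr.
  by move=> [n _ []/= ? ?]; split; exists n.
move=> k; have [? ?] := Foo k; have [? ?] := Goo k.
split; first exact: measurableX.
by rewrite product_measure1E// lte_mul_pinfty// ge0_fin_numE.
Qed.

Section SigmaFinitePack.
Context d (T : measurableType d) (R : realType).
Variables (m : {measure set T -> \bar R}) (sf : sigma_finite setT m).

Let m' : set T -> \bar R := m.
HB.instance Definition _ := Measure.on m'.
HB.instance Definition _ := Measure_isSigmaFinite.Build _ _ _ m' sf.

Lemma sigma_finite_pack :
  exists m0 : {sigma_finite_measure set T -> \bar R}, m0 = m :> (_ -> _).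
Proof. by exists m'. Qed.
End SigmaFinitePack.

Section LebesgueTuple.
Context (R : realType).
Local Notation RT := (measurableTypeR R).

Definition cons_pair n (p : RT * n.-tuple RT) : n.+1.-tuple RT :=
  [tuple of p.1 :: p.2].

Fixpoint lebesgue_tuple n : set (n.-tuple RT) -> \bar R :=
  match n with
  | 0 => \d_([tuple] : 0.-tuple RT)
  | n'.+1 => pushforward (lebesgue_measure \x @lebesgue_tuple n')%E
               (@cons_pair n')
  end.

Lemma measurable_cons_pair n : measurable_fun setT (@cons_pair n).
Proof. exact: measurable_cons. Qed.

Lemma lebesgue_tuple_subproof n :
  exists2 m : {measure set (n.-tuple RT) -> \bar R},
    m = @lebesgue_tuple n :> (_ -> _) & sigma_finite setT m.
Proof.
elim: n => [|n [m0 IH /sigma_finite_pack[m mE]]].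
  exists [the {measure set _ -> \bar R} of \d_([tuple] : 0.-tuple RT)] => //.
  exact: sigma_finiteT.
have [F TF mF] := sigma_finite_product (@lebesgue_measure R) m.
exists (measure_function_pushforward__canonical__measure_function_Measure
  (lebesgue_measure \x m)%E (@measurable_cons_pair n)).
  by rewrite /= -IH -mE.
pose g (t : n.+1.-tuple RT) : RT * n.-tuple RT :=
  (thead t, [tuple of behead t]).
have mg : measurable_fun setT g.
  apply/measurable_fun_pairP; split; last exact: measurable_behead.
  exact: measurable_tnth.
have gK : cancel (@cons_pair n) g.
  by case=> x t; rewrite /g /cons_pair theadE; congr pair; apply/val_inj.
exists (fun k => g @^-1` F k).
  by rewrite -preimage_bigcup -TF preimage_setT.
move=> k; have [mFk Fkoo] := mF k; split.
  by rewrite -[X in measurable X]setTI; exact: mg.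
rewrite /= /pushforward -comp_preimage.
by rewrite (_ : g \o _ = id) ?preimage_id //; apply/funext.
Qed.

Section instances.
Variable n : nat.

Let mu0 : @lebesgue_tuple n set0 = 0%E.
Proof. by case: (lebesgue_tuple_subproof n) => m <- _; rewrite measure0. Qed.

Let mu_ge0 A : (0 <= @lebesgue_tuple n A)%E.
Proof. by case: (lebesgue_tuple_subproof n) => m <- _; rewrite measure_ge0. Qed.

Let mu_sigma_additive : semi_sigma_additive (@lebesgue_tuple n).
Proof.
case: (lebesgue_tuple_subproof n) => m <- _.
exact: measure_semi_sigma_additive.
Qed.

HB.instance Definition _ := isMeasure.Build _ _ _ (@lebesgue_tuple n)
  mu0 mu_ge0 mu_sigma_additive.

Let mu_sigma_finite : sigma_finite setT (@lebesgue_tuple n).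
Proof. by case: (lebesgue_tuple_subproof n) => m <-. Qed.

HB.instance Definition _ := Measure_isSigmaFinite.Build _ _ _
  (@lebesgue_tuple n) mu_sigma_finite.
End instances.

Lemma lebesgue_tuple_box n (A : 'I_n -> set RT) :
  (forall i, measurable (A i)) ->
  measurable [set t : n.-tuple RT | forall i, A i (tnth t i)] /\
  lebesgue_tuple [set t : n.-tuple RT | forall i, A i (tnth t i)]
    = (\prod_(i < n) lebesgue_measure (A i))%E.
Proof.
elim: n A => [|n IH] A mA.
  rewrite (_ : [set _ | _] = setT); last by apply/seteqP; split=> // t _ [].
  by rewrite big_ord0 /= diracT; split.
have [mS muS] := IH (fun i : 'I_n => A (lift ord0 i)) (fun i => mA _).
split.
  rewrite (_ : [set _ | _] = \bigcap_(i in [set: 'I_n.+1])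
     ((fun t => tnth t i) @^-1` A i)).
    apply: fin_bigcap_measurable => // i _.
    by rewrite -[X in measurable X]setTI; apply: measurable_tnth.
  by apply/seteqP; split => [t h i _|t h i]; apply: h.
rewrite /= /pushforward.
rewrite (_ : _ @^-1` _ = A ord0 `*`
    [set t : n.-tuple RT | forall i : 'I_n, A (lift ord0 i) (tnth t i)]).
  rewrite big_ord_recl -muS.
  have [m mE _] := lebesgue_tuple_subproof n.
  exact: product_measure1E.
apply/seteqP; split => [[x t] /= h|[x t] /= [h0 h] i].
  split; first exact: (h ord0).
  by move=> i; have := h (lift ord0 i); rewrite (tnthS).
by have [j ->|->] := unliftP ord0 i; rewrite ?tnthS; [exact: h|exact: h0].
Qed.
End LebesgueTuple.

Section LebesgueRow.
Context (R : realType) (N : nat).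
Local Notation RT := (measurableTypeR R).

Definition tuple_of_row (v : 'rV[R]_N) : N.-tuple RT := [tuple v ord0 i | i < N].
Definition row_of_tuple (t : N.-tuple RT) : 'rV[R]_N := \row_i tnth t i.

Lemma row_of_tupleK : cancel row_of_tuple tuple_of_row.
Proof.
by move=> t; apply: eq_from_tnth => i; rewrite tnth_mktuple mxE.
Qed.

(* The sigma-algebra on R^N generated by the coordinates. *)
Definition borel_row := g_sigma_algebra_preimageType tuple_of_row.
HB.instance Definition _ := Measurable.on borel_row.

Lemma measurable_row_of_tuple :
  measurable_fun setT (row_of_tuple : N.-tuple RT -> borel_row).
Proof.
move=> _ _ [B mB <-]; rewrite !setTI -comp_preimage.
by rewrite (_ : _ \o _ = id) ?preimage_id//; apply/funext => t; exact: row_of_tupleK.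
Qed.

Definition borel_lebesgue_row : set borel_row -> \bar R :=
  pushforward (@lebesgue_tuple R N)
    (row_of_tuple : N.-tuple RT -> borel_row).

HB.instance Definition _ := Measure.copy borel_lebesgue_row
  (measure_function_pushforward__canonical__measure_function_Measure
    (@lebesgue_tuple R N) measurable_row_of_tuple).

(* R^N with the Lebesgue measurable sets: the sigma-algebra of the completed
   product measure. *)
Definition lebesgue_row_type := caratheodory_type (borel_lebesgue_row^*)%mu.
HB.instance Definition _ := Measurable.on lebesgue_row_type.

Definition lebesgue_row : set lebesgue_row_type -> \bar R :=
  @completed_measure_extension _ _ _ borel_lebesgue_row.
HB.instance Definition _ := Measure.on lebesgue_row.

Lemma lebesgue_row_box (A : 'I_N -> set RT) :
  (forall i, measurable (A i)) ->
  lebesgue_row [set v : 'rV[R]_N | forall i, A i (v ord0 i)]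
    = (\prod_(i < N) lebesgue_measure (A i))%E.
Proof.
move=> mA; have [mS muS] := lebesgue_tuple_box mA.
rewrite /lebesgue_row /completed_measure_extension.
have E : [set v : 'rV[R]_N | forall i, A i (v ord0 i)] =
  tuple_of_row @^-1` [set t : N.-tuple RT | forall i, A i (tnth t i)].
  by apply/seteqP; split => v /= h i; have := h i; rewrite tnth_mktuple.
rewrite measurable_mu_extE; last first.
  by rewrite E; exists [set t : N.-tuple RT | forall i, A i (tnth t i)] => //; rewrite setTI.
rewrite -muS /= /borel_lebesgue_row /pushforward E -comp_preimage.
rewrite (_ : _ \o _ = id) ?preimage_id//; apply/funext => t.
exact: row_of_tupleK.
Qed.

End LebesgueRow.

Section Euclidean.
Context {R : realType} {N : nat}.
Local Notation rV := 'rV[R]_N.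
Implicit Types (x y : rV) (u v psi K : rV -> R) (U G Omega : set rV).

(* The library norm on matrices is the sup norm. *)
Definition enorm x : R := Num.sqrt (\sum_i x ord0 i ^+ 2).

Definition enorm_pinfty : set_system rV :=
  filter_from [set: R] (fun M => [set x | M < enorm x]).

Definition usc_on (A : set rV) u : Prop :=
  lower_semicontinuous (fun x : subspace A => (- u x)%:E).

Definition lsc_on (A : set rV) u : Prop :=
  lower_semicontinuous (fun x : subspace A => (u x)%:E).

(* Partial derivatives up to order k exist and are continuous; meant for open
   U. *)
Fixpoint Ck_on (k : nat) U u : Prop :=
  {within U, continuous u} /\
  match k with
  | 0 => True
  | k'.+1 => forall i : 'I_N,
      (forall x, U x -> derivable u x (delta_mx ord0 i)) /\
      Ck_on k' U ('D_(delta_mx ord0 i) u)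
  end.

(* Near each boundary point, up to relabelling and reflecting the coordinate
   axes, G is the strict epigraph of a C^2 function g of the other N - 1
   coordinates; g is encoded as a function on R^N not depending on x_i. *)
Definition C2_boundary G : Prop :=
  forall x0, (closure G `\` interior G) x0 ->
  exists U (i : 'I_N) (b : bool) (g : rV -> R),
    [/\ open U /\ U x0,
        forall x y, (forall j, j != i -> x ord0 j = y ord0 j) -> g x = g y,
        Ck_on 2 U g &
        forall x, U x -> (G x <-> g x < (-1) ^+ b * x ord0 i)].

Definition bounded_C2_domain G : Prop :=
  [/\ G !=set0, open G, connected G, bounded_set G & C2_boundary G].

Variable s : R.
Local Notation mu := (@lebesgue_row R N).
Local Notation p := (N%:R + 2 * s).

Definition L1_omega u : Prop :=
  measurable_fun [set: lebesgue_row_type R N] u /\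
  (\int[mu]_x (`|u x| / (1 + enorm x `^ p))%:E < +oo)%E.

(* Extended-real valued, so that suprema and infima of such values need no
   side condition. *)
Definition pv_operator K u x : \bar R :=
  lim ((\int[mu]_(y in [set y | (eps <= enorm y)%R])
          ((u (x + y) - u x) * K y)%:E)%E @[eps --> (0 : R)^'+]).

Definition admissible_kernel (lam Lam : R) K : Prop :=
  [/\ measurable_fun [set: lebesgue_row_type R N] K,
      forall y, K y = K (- y) &
      forall y, y != 0 -> lam / enorm y `^ p <= K y <= Lam / enorm y `^ p].

Definition class_L (lam Lam : R) : set ((rV -> R) -> rV -> \bar R) :=
  [set L | exists2 K, admissible_kernel lam Lam K & L = pv_operator K].

Section Viscosity.
Variable I : (rV -> R) -> rV -> \bar R.

Definition viscosity_subsolution Omega (V f u : rV -> R) : Prop :=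
  [/\ usc_on Omega u, L1_omega u &
      forall x (Nx : set rV) psi,
        open Nx -> Nx x -> Nx `<=` Omega ->
        L1_omega psi -> Ck_on 2 Nx psi -> psi x = u x ->
        (forall y, u y <= psi y) ->
        ((f x)%:E <= I psi x + (V x * u x)%:E)%E].

Definition viscosity_supersolution Omega (V f u : rV -> R) : Prop :=
  [/\ lsc_on Omega u, L1_omega u &
      forall x (Nx : set rV) phi,
        open Nx -> Nx x -> Nx `<=` Omega ->
        L1_omega phi -> Ck_on 2 Nx phi -> phi x = u x ->
        (forall y, phi y <= u y) ->
        (I phi x + (V x * u x)%:E <= (f x)%:E)%E].

Definition viscosity_solution Omega (V f u : rV -> R) : Prop :=
  [/\ {within Omega, continuous u}, L1_omega u,
      viscosity_subsolution Omega V f u &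
      viscosity_supersolution Omega V f u].

Definition maximum_principle (V : rV -> R) G : Prop :=
  forall v, usc_on (closure G) v -> L1_omega v ->
    viscosity_subsolution G V (cst 0) v ->
    (forall x, ~ G x -> v x <= 0) -> forall x, v x <= 0.

Definition minimum_principle (V : rV -> R) G : Prop :=
  forall v, lsc_on (closure G) v -> L1_omega v ->
    viscosity_supersolution G V (cst 0) v ->
    (forall x, ~ G x -> 0 <= v x) -> forall x, 0 <= v x.

End Viscosity.
End Euclidean.
Arguments enorm_pinfty : clear implicits.

(* Main.v *)
(* Suppose u(x0) > 0 and let b(x) = (1 + |x|^2)^(-p/2) with p = N + 2s, so that u = o(b) at
   infinity.  For small eps and large r, v = max(u, eps b) - eps b(r) is a subsolution in the ball
   of radius r: where the barrier is active, L(eps b) >= - C eps b by an AM-GM estimate of second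
   differences, while the mass of u near x0 contributes at least c b with c independent of eps;
   where u is active, |x| is bounded independently of r, and replacing u by eps b near infinity
   contributes a fixed positive amount, which absorbs the loss V eps b(r).  Since v <= 0 outside
   the ball, the maximum principle gives v(x0) <= 0, a contradiction as r grows.  The bound u >= 0
   follows by applying this to -u and the operator f |-> - I(-f), which turns the minimum principle
   into the maximum principle. *)
Require Import Defs.
From mathcomp Require Import all_boot all_order all_algebra.
From mathcomp Require Import all_classical all_reals all_analysis.
From mathcomp Require Import measurable_realfun.
From mathcomp Require Import ring lra.
Set Implicit Arguments.
Unset Strict Implicit.
Unset Printing Implicit Defensive.
Import Order.TTheory GRing.Theory Num.Theory.
Import numFieldNormedType.Exports.
Local Open Scope classical_set_scope.
Local Open Scope ring_scope.

(** * Invariance of Lebesgue measure *)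

(** The exponent of b is dictated by the kernels: when x + y runs over a fixed cube, K(y) is at
    least a constant times b(x), uniformly in x. In the barrier region the gain, the loss in L(eps
    b) and the bound on V eps b therefore all carry the factor b(x), and one small eps serves every
    x at once. The obstacle is that I is nonlinear and that a test function is smooth only near the
    contact point. All estimates are thus put in the form L f(x) + gain <= L g(x), where the gain
    depends on the kernel only through lam and Lam; this form survives suprema, infima and the
    passage to - I(-f). Since a principal value is half of an absolutely convergent integral of
    second differences against K, pointwise inequalities between second differences are all that has
    to be supplied. The constants are not circular: eps depends on u near x0, on lam, Lam and on the
    bound of V; the decay of u at rate eps/2 gives M, outside which u is inactive; a far cube beyond
    M fixes the second gain; the radius r comes last, large enough for eps b(r) to cost less than
    that gain. *)

Section reflection_translation.
Context {R : realType}.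
Local Notation RT := (measurableTypeR R).
Variable b : bool.
Local Notation sg := ((-1) ^+ b : R).

(** The sign treats translations and reflections together. Translations are needed to carry the
    weight to x + y, the reflection y -> - y to symmetrize principal values. *)
Let shift (c : R) : RT -> RT := fun x => c + sg * x.

Let measurable_shift c : measurable_fun setT (shift c).
Proof.
by apply: measurable_funD => //; exact: measurable_funM.
Qed.

(** By uniqueness it is enough to test half-open intervals. A reflection moves the closed end to the
    other side, which leaves the length unchanged. *)
Lemma lebesgue_measure_shift (c : R) (B : set RT) : measurable B ->
  lebesgue_measure (shift c @^-1` B) = lebesgue_measure B.
Proof.
move=> mB.
pose m := measure_function_pushforward__canonical__measure_function_Measure
  (@lebesgue_measure R) (measurable_shift c).
apply/esym/(@lebesgue_measure_unique _ m) => //= _ [[a d]] _ <-.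
rewrite /pushforward.
have -> : shift c @^-1` `]a, d] =
    if b then `[c - d, c - a[%classic else `]a - c, d - c]%classic.
  rewrite /shift; case: (b); apply/seteqP; split => x /=;
    rewrite !in_itv/= ?expr1 ?expr0 ?mulN1r ?mul1r; move=> /andP[? ?]; apply/andP; split; lra.
case: (b); rewrite !lebesgue_measure_itv/= !lte_fin.
  have -> : (c - d < c - a) = (a < d) by apply/idP/idP; lra.
  by case: ifP => // _; rewrite -!EFinD; congr EFin; ring.
have -> : (a - c < d - c) = (a < d) by apply/idP/idP; lra.
by case: ifP => // _; rewrite -!EFinD; congr EFin; ring.
Qed.

Lemma ge0_integral_lebesgue_shift (c : R) (f : RT -> \bar R) :
  measurable_fun setT f -> (forall x, 0 <= f x)%E ->
  (\int[lebesgue_measure]_x f (shift c x) = \int[lebesgue_measure]_x f x)%E.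
Proof.
move=> mf f0.
pose m := measure_function_pushforward__canonical__measure_function_Measure
  (@lebesgue_measure R) (measurable_shift c).
transitivity (\int[m]_x f x)%E; first by rewrite ge0_integral_pushforward.
by apply: eq_measure_integral => B mB _; exact: lebesgue_measure_shift.
Qed.

Definition tuple_shift n (c : n.-tuple R) (t : n.-tuple RT) : n.-tuple RT :=
  [tuple shift (tnth c i) (tnth t i) | i < n].

Lemma measurable_tuple_shift n (c : n.-tuple R) :
  measurable_fun setT (tuple_shift c).
Proof.
apply/measurable_fun_tnthP => i.
rewrite [X in measurable_fun _ X](_ : _ = shift (tnth c i) \o (fun t => tnth t i)).
  by apply: measurableT_comp => //; exact: measurable_tnth.
by apply/funext => t /=; rewrite tnth_mktuple.
Qed.

(** The product measure integrates the measures of sections: the induction hypothesis handles the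
    shift inside each section, one-dimensional invariance the shift of the base variable. *)
Lemma lebesgue_tuple_shift n (c : n.-tuple R) (B : set (n.-tuple RT)) :
  measurable B -> lebesgue_tuple (tuple_shift c @^-1` B) = lebesgue_tuple B.
Proof.
elim: n c B => [|n IH] c B mB.
  congr (lebesgue_tuple _); rewrite (_ : tuple_shift c = id) ?preimage_id//.
  by apply/funext => t; rewrite tuple0 [RHS]tuple0.
rewrite /= /pushforward /product_measure1.
pose B' := @cons_pair R n @^-1` B.
have mB' : measurable B'.
  by have := @measurable_cons_pair R n measurableT _ mB; rewrite setTI.
pose c' := [tuple of behead c].
transitivity (\int[lebesgue_measure]_x
   lebesgue_tuple (xsection B' (shift (thead c) x)))%E; last first.
  rewrite (ge0_integral_lebesgue_shift _ (f := fun x => lebesgue_tuple (xsection B' x))) //.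
  have := @measurable_fun_xsection _ _ RT (n.-tuple RT) R (@lebesgue_tuple R n) B' mB'; exact.
apply: eq_integral => x _ /=.
have -> : xsection (@cons_pair R n @^-1` (tuple_shift c @^-1` B)) x =
    tuple_shift c' @^-1` xsection B' (shift (thead c) x).
  suff E t : tuple_shift c (cons_pair (x, t)) =
      cons_pair (shift (thead c) x, tuple_shift c' t).
    rewrite !xsectionE; apply/funext => t.
    by rewrite /B' /preimage/= E.
  apply: eq_from_tnth => i.
  rewrite tnth_mktuple; have [j ->|->] := unliftP ord0 i; last by [].
  rewrite !tnthS tnth_mktuple tnth_behead.
  by congr (shift (tnth c _) _); apply/val_inj; rewrite /= inordK ?ltnS.
by rewrite IH//; exact: measurable_xsection.
Qed.

Context {N : nat}.
Local Notation rV := 'rV[R]_N.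
Local Notation bT := (borel_row R N).
Local Notation lT := (lebesgue_row_type R N).

Definition row_shift (c y : rV) : rV := c + sg *: y.

Lemma row_shiftK (c : rV) : cancel (row_shift c) (row_shift (- (sg *: c))).
Proof.
by move=> y; rewrite /row_shift scalerDr addrA addNr add0r scalerA -expr2 sqrr_sign scale1r.
Qed.

Lemma row_shiftK' (c : rV) : cancel (row_shift (- (sg *: c))) (row_shift c).
Proof.
move=> y; rewrite /row_shift scalerDr scalerN !scalerA -expr2 sqrr_sign !scale1r.
by rewrite addrA addrN add0r.
Qed.

Lemma borel_row_shift (c : rV) (B : set bT) : measurable B ->
  measurable (row_shift c @^-1` B : set bT) /\
  borel_lebesgue_row (row_shift c @^-1` B : set bT) = borel_lebesgue_row B.
Proof.
move=> [B' mB' <-]; rewrite !setTI.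
have E : row_shift c @^-1` (@tuple_of_row R N @^-1` B') =
   @tuple_of_row R N @^-1` (tuple_shift (tuple_of_row c) @^-1` B').
  suff F y : tuple_of_row (row_shift c y) = tuple_shift (tuple_of_row c) (tuple_of_row y).
    by apply/funext => y; rewrite /preimage/= F.
  by apply: eq_from_tnth => i; rewrite !tnth_mktuple !mxE.
have mS : measurable (tuple_shift (tuple_of_row c) @^-1` B').
  by rewrite -[X in measurable X]setTI; exact: measurable_tuple_shift.
rewrite E; split; first by exists (tuple_shift (tuple_of_row c) @^-1` B') => //; rewrite setTI.
have K (C : set (N.-tuple RT)) : @row_of_tuple R N @^-1` (@tuple_of_row R N @^-1` C) = C.
  by apply/funext => t; rewrite /preimage/= row_of_tupleK.
by rewrite /borel_lebesgue_row /pushforward !K lebesgue_tuple_shift.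
Qed.

Local Notation mue := (mu_ext (@borel_lebesgue_row R N)).

Let mu_ext_row_shift_le (c : rV) (B : set rV) :
  (mue (row_shift c @^-1` B) <= mue B)%E.
Proof.
apply: le_ereal_inf_tmp => _ [C [mC BC] <-].
apply: ereal_inf_lbound; exists (fun k => row_shift c @^-1` C k).
  split => [k|x /BC[k _ Ck]]; last by exists k.
  exact: (borel_row_shift c (mC k)).1.
by apply: eq_eseriesr => k _; rewrite (borel_row_shift c (mC k)).2.
Qed.

(** Countable measurable covers pull back to covers of the same total measure, which gives one
    inequality; the inverse map is again a [row_shift], which gives the other. *)
Lemma mu_ext_row_shift (c : rV) (B : set rV) : mue (row_shift c @^-1` B) = mue B.
Proof.
apply/eqP; rewrite eq_le mu_ext_row_shift_le/=.
have := mu_ext_row_shift_le (- (sg *: c)) (row_shift c @^-1` B).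
rewrite (_ : _ @^-1` (_ @^-1` _) = B)//.
by apply/funext => y; rewrite /preimage/= row_shiftK'.
Qed.

(** Measurability in the completed sigma-algebra is the Caratheodory condition, which only involves
    the outer measure and so inherits its invariance. *)
Lemma measurable_row_shift (c : rV) :
  measurable_fun [set: lT] (row_shift c : lT -> lT).
Proof.
move=> _ B mB; rewrite setTI.
suff : caratheodory_measurable mue (row_shift c @^-1` B) by [].
move=> X; have -> : X = row_shift c @^-1` (row_shift (- (sg *: c)) @^-1` X).
  by apply/funext => y; rewrite /preimage/= row_shiftK.
rewrite preimage_setC -!preimage_setI !(mu_ext_row_shift c).
exact: mB.
Qed.

Lemma lebesgue_row_shift (c : rV) (B : set lT) :
  lebesgue_row (row_shift c @^-1` B : set lT) = lebesgue_row B.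
Proof. exact: mu_ext_row_shift. Qed.

Local Notation mu := (@lebesgue_row R N).
Local Open Scope ereal_scope.

Lemma ge0_integral_row_shift (c : rV) (D : set lT) (f : lT -> \bar R) :
  measurable D -> measurable_fun D f -> (forall x, D x -> 0 <= f x) ->
  \int[mu]_(y in row_shift c @^-1` D) f (row_shift c y) = \int[mu]_(y in D) f y.
Proof.
move=> mD mf f0.
pose m := measure_function_pushforward__canonical__measure_function_Measure
  mu (measurable_row_shift c).
transitivity (\int[m]_(y in D) f y).
  have f0' : {in D, forall y, 0 <= f y} by move=> x /set_mem; exact: f0.
  by rewrite (ge0_integral_pushforward (measurable_row_shift c) mu mD mf f0').
by apply: eq_measure_integral => B mB _; exact: lebesgue_row_shift.
Qed.

Lemma integral_row_shift (c : rV) (D : set lT) (f : lT -> \bar R) :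
  measurable D -> measurable_fun D f ->
  \int[mu]_(y in row_shift c @^-1` D) f (row_shift c y) = \int[mu]_(y in D) f y.
Proof.
move=> mD mf; rewrite [LHS]integralE [RHS]integralE.
rewrite -(ge0_integral_row_shift c mD (measurable_funepos mf)) => [|x _]; last exact: funepos_ge0.
rewrite -(ge0_integral_row_shift c mD (measurable_funeneg mf)) => [|x _]; last exact: funeneg_ge0.
by congr (_ - _); apply: eq_integral => y _; rewrite ?funeposE ?funenegE.
Qed.

End reflection_translation.

(** * The Euclidean norm and the Levy weight *)

Section euclidean_norm.
Context {R : realType} {N : nat}.
Local Notation rV := 'rV[R]_N.
Implicit Types x y : rV.

Lemma enorm_ge0 x : 0 <= enorm x.
Proof. exact: sqrtr_ge0. Qed.

Lemma sqr_enorm x : enorm x ^+ 2 = \sum_i x ord0 i ^+ 2.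
Proof. by rewrite sqr_sqrtr// sumr_ge0// => i _; exact: sqr_ge0. Qed.

Lemma coord_le_enorm x i : `|x ord0 i| <= enorm x.
Proof.
rewrite -(@ler_pXn2r _ 2)// ?nnegrE ?enorm_ge0// real_normK ?num_real//.
by rewrite sqr_enorm (bigD1 i)//= lerDl sumr_ge0// => j _; exact: sqr_ge0.
Qed.

Lemma enorm_le_coord x r : 0 <= r -> (forall i, `|x ord0 i| <= r) ->
  enorm x <= N%:R * r.
Proof.
move=> r0 xr; have Nr0 : 0 <= N%:R * r by rewrite mulr_ge0.
rewrite -(@ler_pXn2r _ 2)// ?nnegrE ?enorm_ge0// sqr_enorm exprMn.
apply: (@le_trans _ _ (\sum_(i < N) r ^+ 2)).
  apply: ler_sum => i _; rewrite -[leLHS]real_normK ?num_real//.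
  by rewrite ler_pXn2r ?nnegrE.
rewrite sumr_const card_ord -[r ^+ 2 *+ N]mulr_natl ler_wpM2r ?sqr_ge0//.
by rewrite -natrX ler_nat; case: (N) => // n; rewrite leq_pmulr.
Qed.

Lemma enorm0 : enorm (0 : rV) = 0.
Proof.
by rewrite /enorm big1 ?sqrtr0// => i _; rewrite mxE expr0n.
Qed.

Lemma enorm_eq0 x : enorm x = 0 -> x = 0.
Proof.
move=> x0; apply/rowP => i; rewrite mxE; apply/eqP; rewrite -normr_le0 -x0.
exact: coord_le_enorm.
Qed.

Lemma enorm_gt0 x : x != 0 -> 0 < enorm x.
Proof.
by move=> x0; rewrite lt_neqAle enorm_ge0 andbT; apply: contra_neq x0 => /esym/enorm_eq0.
Qed.

Lemma enormN x : enorm (- x) = enorm x.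
Proof. by congr Num.sqrt; apply: eq_bigr => i _; rewrite mxE sqrrN. Qed.

Lemma enormZ a x : enorm (a *: x) = `|a| * enorm x.
Proof.
rewrite /enorm -sqrtr_sqr -sqrtrM ?sqr_ge0//; congr Num.sqrt.
by rewrite mulr_sumr; apply: eq_bigr => i _; rewrite mxE exprMn.
Qed.

(** The factor 2 comes from the coordinatewise bound (a + b)^2 <= 2 a^2 + 2 b^2, which avoids
    Cauchy-Schwarz; every later use tolerates a constant. *)
Lemma enormD_le2 x y : enorm (x + y) <= 2 * (enorm x + enorm y).
Proof.
have := enorm_ge0 x; have := enorm_ge0 y => y0 x0.
rewrite -(@ler_pXn2r _ 2)// ?nnegrE ?enorm_ge0//; last by rewrite mulr_ge0// addr_ge0.
apply: (@le_trans _ _ (2 * (enorm x ^+ 2 + enorm y ^+ 2))).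
  rewrite !sqr_enorm -big_split mulr_sumr /=; apply: ler_sum => i _; rewrite mxE.
  have := sqr_ge0 (x ord0 i - y ord0 i); move: (x _ _) (y _ _) => a b; rewrite !expr2; nra.
nra.
Qed.

Lemma enorm_le_mxnorm x : enorm x <= N%:R * `|x|.
Proof.
apply: enorm_le_coord => // i.
by rewrite [leRHS]/Num.norm/= mx_normrE; apply/bigmax_geP; right; exists (ord0, i).
Qed.

Lemma mxnorm_le_enorm x : `|x| <= enorm x.
Proof.
rewrite [leLHS]/Num.norm/= mx_normrE; apply/bigmax_leP; split; first exact: enorm_ge0.
by move=> [i j] _ /=; rewrite (ord1 i); exact: coord_le_enorm.
Qed.

Lemma continuous_enorm : continuous (@enorm R N).
Proof.
move=> x; apply: (@continuous_comp _ _ _ (fun x : rV => \sum_i x ord0 i ^+ 2) Num.sqrt).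
  apply: continuous_big => [|i _ {}x]; first exact: add_continuous.
  apply: (@continuous_comp _ _ _ (fun x : rV => x ord0 i) (fun a => a ^+ 2)).
    exact: coord_continuous.
  exact: exprn_continuous.
exact: sqrt_continuous.
Qed.

End euclidean_norm.

(** * Measurability of the norm and of boxes *)

Section measurability.
Context {R : realType} {N : nat}.
Local Notation rV := 'rV[R]_N.
Local Notation lT := (lebesgue_row_type R N).

Lemma measurable_coord i : measurable_fun [set: lT] (fun x : lT => (x : rV) ord0 i).
Proof.
move=> _ B mB; rewrite setTI.
suff : measurable ((fun x : rV => x ord0 i) @^-1` B : set (borel_row R N)).
  exact: caratheodory_measurable_mu_ext.
exists ((fun t => tnth t i) @^-1` B).
  by rewrite -[X in measurable X]setTI; exact: measurable_tnth.
by rewrite setTI; apply/funext => x; rewrite /preimage/= tnth_mktuple.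
Qed.

Lemma measurable_enorm : measurable_fun [set: lT] (@enorm R N).
Proof.
have -> : @enorm R N = (fun a => a `^ 2^-1) \o (fun x : rV => \sum_i x ord0 i ^+ 2).
  by apply/funext => x /=; rewrite powR12_sqrt// sumr_ge0// => i _; exact: sqr_ge0.
apply: measurableT_comp; first exact: measurable_powR.
by apply: measurable_sum => i; apply: measurable_funX; exact: measurable_coord.
Qed.

Lemma measurable_box (B : 'I_N -> set R) : (forall i, measurable (B i)) ->
  measurable ([set v : rV | forall i, B i (v ord0 i)] : set lT).
Proof.
move=> mB.
have -> : [set v : rV | forall i, B i (v ord0 i)] =
    \bigcap_(i in [set: 'I_N]) ((fun x : rV => x ord0 i) @^-1` B i).
  by apply/seteqP; split => v h i => [_|]; exact: h.
apply: fin_bigcap_measurable => // i _.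
by rewrite -[X in measurable X]setTI; exact: measurable_coord.
Qed.

Lemma measurable_enorm_ge (r : R) : measurable ([set y : rV | r <= enorm y] : set lT).
Proof.
rewrite (_ : [set _ | _] = [set: lT] `&` @enorm R N @^-1` `[r, +oo[).
  exact: measurable_enorm.
by apply/seteqP; split => y /=; rewrite in_itv/= andbT => // -[].
Qed.

Lemma measurable_enorm_powR (p : R) : measurable_fun [set: lT] (fun y => enorm y `^ p).
Proof.
exact: (measurableT_comp (measurable_powR p) measurable_enorm).
Qed.

Lemma lebesgue_row_cube (a b : 'I_N -> R) (l : R) : 0 <= l -> (forall i, b i - a i = l) ->
  lebesgue_row [set v : rV | forall i, `]a i, b i[%classic (v ord0 i)] = (l ^+ N)%:E.
Proof.
move=> l0 abl; rewrite (@lebesgue_row_box R N (fun i => `]a i, b i[%classic))//.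
rewrite (eq_bigr (fun=> l%:E)).
  by rewrite prodEFin prodr_const card_ord.
move=> i _; rewrite lebesgue_measure_itv/= lte_fin -EFinD abl.
case: ifPn => //; rewrite -subr_gt0 abl -leNgt => l0'; congr EFin.
by apply/eqP; rewrite eq_le l0 l0'.
Qed.
End measurability.

Section indicator_series.
Context d (T : measurableType d) {R : realType} (mu : {measure set T -> \bar R}).

Lemma integrable_le_indic_series (f : T -> R) (a b : nat -> R) (F G : nat -> set T) :
  measurable_fun setT f -> (forall x, 0 <= f x) ->
  (forall k, 0 <= a k) -> (forall k, 0 <= b k) ->
  (forall k, measurable (F k)) -> (forall k, measurable (G k)) ->
  (forall x, (f x)%:E <=
    \sum_(k <oo) ((a k)%:E * (\1_(F k) x)%:E + (b k)%:E * (\1_(G k) x)%:E))%E ->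
  (\sum_(k <oo) ((a k)%:E * mu (F k) + (b k)%:E * mu (G k)) < +oo)%E ->
  mu.-integrable setT (EFin \o f).
Proof.
move=> mf f0 a0 b0 mF mG fle lty.
have mEf : measurable_fun setT (EFin \o f) by exact: measurableT_comp.
apply/integrableP; split => //.
have mi (B : set T) : measurable B -> measurable_fun [set: T] (fun y => (\1_B y)%:E : \bar R).
  by move=> mB; apply: measurableT_comp => //; exact: measurable_indic.
have intZ (B : set T) c : measurable B -> 0 <= c ->
    (\int[mu]_y (c%:E * (\1_B y)%:E) = c%:E * mu B)%E.
  move=> mB c0; rewrite ge0_integralZl_EFin//; last exact: mi.
  by rewrite integral_indic// setIT.
apply: (@le_lt_trans _ _ (\int[mu]_y
    \sum_(k <oo) ((a k)%:E * (\1_(F k) y)%:E + (b k)%:E * (\1_(G k) y)%:E))%E).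
  apply: ge0_le_integral => //.
  - exact: measurableT_comp.
  - apply: ge0_emeasurable_sum => k *; first by rewrite adde_ge0// mule_ge0 ?lee_fin.
    by apply: emeasurable_funD; apply: measurable_funeM; exact: mi.
  - by move=> y _ /=; rewrite ger0_norm.
rewrite integral_nneseries//; last 2 first.
- by move=> k; apply: emeasurable_funD; apply: measurable_funeM; exact: mi.
- by move=> k y _; rewrite adde_ge0// mule_ge0 ?lee_fin.
under eq_eseriesr => k _.
  rewrite ge0_integralD//; last 4 first.
  - by move=> y _; rewrite mule_ge0 ?lee_fin.
  - by apply: measurable_funeM; exact: mi.
  - by move=> y _; rewrite mule_ge0 ?lee_fin.
  - by apply: measurable_funeM; exact: mi.
  rewrite !intZ//.
  over.
exact: lty.
Qed.
End indicator_series.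

(** * Integrability of the Levy weight by dyadic shells *)

Section singular_integrals.
Context {R : realType} {N : nat}.
Variables (s : R) (s0 : 0 < s) (s1 : s < 1).
Local Notation rV := 'rV[R]_N.
Local Notation lT := (lebesgue_row_type R N).
Local Notation mu := (@lebesgue_row R N).
Local Notation p := (N%:R + 2 * s).

Let cube (r : R) : set rV := [set v | forall i, `](- r), r[%classic (v ord0 i)].

Let cubeP r (v : rV) : cube r v <-> forall i, `|v ord0 i| < r.
Proof.
by split => h i; have := h i; rewrite /= in_itv/= ltr_norml.
Qed.

Let mcube r : measurable (cube r : set lT).
Proof. exact: (@measurable_box R N (fun=> `](- r), r[%classic)). Qed.

Let mucube r : 0 <= r -> mu (cube r) = ((2 * r) ^+ N)%:E.
Proof. by move=> r0; apply: lebesgue_row_cube => [|i]; [lra|ring]. Qed.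

Let Ncube_le r (v : rV) : ~ cube r v -> r <= enorm v.
Proof.
move=> h; rewrite leNgt; apply/negP => vr; apply: h; apply/cubeP => i.
exact: le_lt_trans (coord_le_enorm _ _) vr.
Qed.

Let cube_ge r (v : rV) : 0 <= r -> cube r v -> enorm v <= N%:R * r.
Proof. by move=> r0 /cubeP h; apply: enorm_le_coord => // i; exact/ltW. Qed.

Let hlf : R := 2^-1.
Let hlf0 : 0 < hlf. Proof. by rewrite invr_gt0. Qed.

(** The shell is found through a minimal exponent: the first small cube that misses v if v lies in
    the unit cube, the first large cube that contains v otherwise. *)
Let dyadic (v : rV) : v != 0 -> exists k,
  (cube (hlf ^+ k) v /\ ~ cube (hlf ^+ k.+1) v) \/
  (cube (2 ^+ k.+1) v /\ ~ cube (2 ^+ k) v).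
Proof.
move=> v0; have [v1|v1] := pselect (cube 1 v).
  have [i vi0] : exists i, v ord0 i != 0.
    apply: contrapT => /forallNP h; move/eqP: v0; apply; apply/rowP => i.
    by rewrite mxE; apply/eqP; have /negP := h i; rewrite negbK.
  have ex : exists k, ~~ `[< cube (hlf ^+ k) v >].
    have [k kv] : exists k, `|v ord0 i|^-1 <= 2 ^+ k.
      exists (Num.bound (`|v ord0 i|^-1)).
      apply: ltW; apply: lt_le_trans (archi_boundP _) _; first by rewrite invr_ge0.
      by rewrite -natrX ler_nat ltnW// ltn_expl.
    exists k; apply/asboolPn => /cubeP/(_ i).
    apply/negP; rewrite -leNgt /hlf exprVn invf_ple// ?posrE ?exprn_gt0// ?normr_gt0//.
  case: (ex_minnP ex) => -[|k] /asboolPn k1 kmin.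
    by exfalso; apply: k1; rewrite expr0.
  exists k; left; split=> //; apply: contrapT => /asboolPn /kmin.
  by rewrite ltnn.
have ex : exists k, `[< cube (2 ^+ k) v >].
  exists (Num.bound (enorm v)); apply/asboolP/cubeP => i.
  apply: (le_lt_trans (coord_le_enorm _ _)).
  apply: lt_le_trans (archi_boundP (enorm_ge0 _)) _.
  by rewrite -natrX ler_nat ltnW// ltn_expl.
case: (ex_minnP ex) => -[|k] /asboolP k1 kmin.
  by exfalso; apply: v1; rewrite expr0 in k1.
exists k; right; split=> //; move=> /asboolP /kmin.
by rewrite ltnn.
Qed.

Lemma geometric_eseries_lty (c z : R) : 0 <= z < 1 ->
  (\sum_(k <oo) (c * z ^+ k)%:E < +oo)%E.
Proof.
move=> /andP[z0 z1].
suff -> : (\sum_(k <oo) (c * z ^+ k)%:E = (c * (1 - z)^-1)%:E)%E by rewrite ltry.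
apply/cvg_lim => //; under eq_cvg do rewrite sumEFin.
apply: cvg_EFin; first by near=> n.
have -> : fine \o (fun n => (\sum_(0 <= k < n) c * z ^+ k)%:E) = series (geometric c z).
  by apply/funext => n.
by apply: cvg_geometric_series; rewrite ger0_norm.
Unshelve. all: by end_near. Qed.

Let powRX (x : R) k : 0 <= x -> (x ^+ k) `^ p = (x `^ p) ^+ k.
Proof. by move=> x0; rewrite -powR_mulrn// -powRrM mulrC powRrM powR_mulrn// powR_ge0. Qed.

Let p0 : 0 < p. Proof. by rewrite ltr_wpDl// mulr_gt0. Qed.

(** Of order |y|^(2-p) at 0 and |y|^(-p) at infinity: up to a constant it dominates the product of a
    kernel with a bounded function that is quadratically small at 0. *)
Definition levy_weight (y : rV) : R := Num.min 1 (enorm y ^+ 2) / enorm y `^ p.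

Lemma levy_weight_ge0 y : 0 <= levy_weight y.
Proof. by rewrite divr_ge0 ?powR_ge0// le_min ler01 sqr_ge0. Qed.

Lemma measurable_levy_weight : measurable_fun [set: lT] levy_weight.
Proof.
apply: measurable_funM.
  apply: measurable_minr; first exact: measurable_cst.
  by apply: measurable_funX; exact: measurable_enorm.
under eq_fun do rewrite -powRN.
exact: measurable_enorm_powR.
Qed.

(** [a k] and [b k] bound the weight on the inner and outer shells: the larger cube bounds the
    numerator of [a k], the smaller cube both denominators. *)
Let a k : R := (N%:R * hlf ^+ k) ^+ 2 / (hlf ^+ k.+1) `^ p.
Let b k : R := ((2 ^+ k) `^ p)^-1.
Let a0 k : 0 <= a k. Proof. by rewrite divr_ge0 ?powR_ge0 ?sqr_ge0. Qed.
Let b0 k : 0 <= b k. Proof. by rewrite invr_ge0 powR_ge0. Qed.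

Let step k (y : rV) : \bar R :=
  ((a k)%:E * (\1_(cube (hlf ^+ k)) y)%:E + (b k)%:E * (\1_(cube (2 ^+ k.+1)) y)%:E)%E.

Let step_ge0 k y : (0 <= step k y)%E.
Proof. by rewrite /step -!EFinM -EFinD lee_fin addr_ge0// mulr_ge0. Qed.

Let levy_weight_le y : ((levy_weight y)%:E <= \sum_(k <oo) step k y)%E.
Proof.
have [->|y0] := eqVneq y 0.
  rewrite /levy_weight enorm0 expr0n/= min_r// mul0r.
  by apply: nneseries_ge0 => k _ _; exact: step_ge0.
have ey0 := enorm_gt0 y0.
have [k hk] := dyadic y0.
apply: (@le_trans _ _ (step k y)); last first.
  have := @nneseries_lim_ge R (step ^~ y) xpredT 0%N k.+1 (fun n _ _ => step_ge0 n y).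
  apply: le_trans; rewrite big_nat_recr//= leeDr//.
  by apply: sume_ge0 => i _; exact: step_ge0.
rewrite /step -!EFinM -EFinD lee_fin /levy_weight.
have minl : Num.min 1 (enorm y ^+ 2) <= enorm y ^+ 2 by rewrite ge_min lexx orbT.
have minr : Num.min 1 (enorm y ^+ 2) <= 1 by rewrite ge_min lexx.
case: hk => -[yin yout].
  rewrite ler_wpDr ?mulr_ge0// indicE mem_set// mulr1 /a.
  apply: ler_pM; rewrite ?invr_ge0 ?powR_ge0 ?le_min ?ler01 ?sqr_ge0//.
    apply: le_trans minl _; rewrite ler_pXn2r ?nnegrE ?mulr_ge0 ?enorm_ge0 ?exprn_ge0 ?(ltW hlf0)//.
    by apply: cube_ge => //; rewrite exprn_ge0 ?(ltW hlf0).
  rewrite lef_pV2 ?posrE ?powR_gt0 ?exprn_gt0//.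
  apply: ge0_ler_powR; rewrite ?nnegrE ?(ltW p0) ?enorm_ge0 ?exprn_ge0 ?(ltW hlf0)//.
  exact: Ncube_le.
apply: ler_wpDl; first by rewrite mulr_ge0.
rewrite indicE mem_set// mulr1 /b -[leRHS]mul1r.
apply: ler_pM; rewrite ?invr_ge0 ?powR_ge0 ?le_min ?ler01 ?sqr_ge0//.
rewrite lef_pV2 ?posrE ?powR_gt0 ?exprn_gt0//.
apply: ge0_ler_powR; rewrite ?nnegrE ?(ltW p0) ?enorm_ge0 ?exprn_ge0//.
exact: Ncube_le.
Qed.

Lemma integrable_levy_weight : mu.-integrable setT (EFin \o levy_weight).
Proof.
apply: (@integrable_le_indic_series _ _ _ mu levy_weight a b (fun k => cube (hlf ^+ k))
  (fun k => cube (2 ^+ k.+1)) measurable_levy_weight levy_weight_ge0 a0 b0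
  (fun k => mcube _) (fun k => mcube _) levy_weight_le).
rewrite (eq_eseriesr (g := fun k => (a k * (2 * hlf ^+ k) ^+ N)%:E +
    (b k * (2 * 2 ^+ k.+1) ^+ N)%:E)%E); last first.
  move=> k _; rewrite !EFinM; congr (_ * _ + _ * _)%E; apply: mucube => //.
  by rewrite exprn_ge0// ltW.
rewrite nneseriesD; last 2 first.
- by move=> k _ _; rewrite lee_fin mulr_ge0// exprn_ge0// mulr_ge0// exprn_ge0// ltW.
- by move=> k _ _; rewrite lee_fin mulr_ge0// exprn_ge0// mulr_ge0// exprn_ge0// ltW.
have hp0 : hlf `^ p != 0 by rewrite gt_eqF// powR_gt0.
have tp0 : (2 : R) `^ p != 0 by rewrite gt_eqF// powR_gt0.
apply: lte_add_pinfty.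
  under eq_eseriesr => k _.
    have -> : a k * (2 * hlf ^+ k) ^+ N =
       (N%:R ^+ 2 * 2 ^+ N / hlf `^ p) * (hlf ^+ (2 + N) / hlf `^ p) ^+ k.
      rewrite /a powRX ?(ltW hlf0)// [_ ^+ k.+1]exprS exprD !exprMn [(hlf `^ p)^-1 ^+ k]exprVn.
      rewrite [(hlf ^+ k) ^+ N]exprAC.
      have hpk0 : (hlf `^ p) ^+ k != 0 by rewrite expf_neq0.
      move: (hlf ^+ k) (hlf ^+ N ^+ k) (hlf `^ p) hp0 (_ ^+ k) hpk0 => A B C C0 D D0.
      by field; rewrite C0 D0.
    over.
  (* The ratio is hlf^(2 + N - p) = hlf^(2 (1 - s)), below 1 because s < 1. *)
  apply: geometric_eseries_lty; apply/andP; split.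
    by rewrite divr_ge0 ?powR_ge0// exprn_ge0// ltW.
  rewrite -powR_mulrn ?(ltW hlf0)// -powRB ?(gt_eqF hlf0) ?implybT//.
  have one r : (1 : R) `^ r = 1 by rewrite powR1.
  rewrite -[ltRHS](one (2 + N%:R - p)) natrD.
  have sE : 2 + N%:R - p = 2 * (1 - s) by ring.
  rewrite sE gt0_ltr_powR ?mulr_gt0 ?subr_gt0 ?nnegrE ?(ltW hlf0)//.
  by rewrite invf_lt1// ltr1n.
under eq_eseriesr => k _.
  have -> : b k * (2 * 2 ^+ k.+1) ^+ N = 4 ^+ N * (2 ^+ N / 2 `^ p) ^+ k.
    rewrite /b powRX// [2 ^+ k.+1]exprS !exprMn exprVn.
    rewrite [(2 ^+ k) ^+ N]exprAC.
    have -> : (4 : R) = 2 * 2 by ring.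
    have tpk0 : ((2 : R) `^ p) ^+ k != 0 by rewrite expf_neq0.
    rewrite exprMn; move: (2 ^+ N ^+ k) (2 `^ p ^+ k) tpk0 => A B B0.
    by field; rewrite B0.
  over.
(* The ratio is 2^(N - p) = 2^(- 2 s), below 1 because s > 0. *)
apply: geometric_eseries_lty; apply/andP; split.
  by rewrite divr_ge0 ?powR_ge0// exprn_ge0.
rewrite ltr_pdivrMr ?powR_gt0// mul1r -powR_mulrn//.
rewrite powRD ?pnatr_eq0 ?implybT// ltr_pMr ?powR_gt0//.
have one r : (1 : R) `^ r = 1 by rewrite powR1.
rewrite -[ltLHS](one (2 * s)) gt0_ltr_powR ?mulr_gt0 ?nnegrE// ltr1n//.
Qed.

End singular_integrals.

(** * Principal values as integrals of second differences *)

Section abstract_principal_value.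
Context d (T : measurableType d) {R : realType} (mu : {measure set T -> \bar R}).

Lemma integrable_le_cst (D : set T) (f g : T -> R) (c : R) :
  measurable D -> measurable_fun setT f -> mu.-integrable setT (EFin \o g) ->
  (forall x, D x -> `|f x| <= c * g x) -> mu.-integrable D (EFin \o f).
Proof.
move=> mD mf ig fg.
apply: (@le_integrable _ _ _ mu D mD _ (fun x => c%:E * (EFin \o g) x)%E).
- by apply/measurable_EFinP; exact: measurable_funTS.
- by move=> x Dx /=; rewrite lee_fin (le_trans (fg _ Dx))// ler_norm.
- apply: integrableZl => //; exact: integrableS ig.
Qed.

Variables (e : T -> R) (me : measurable_fun setT e).
Local Notation D eps := [set y | eps <= e y].

Let mD eps : measurable (D eps).
Proof.
rewrite (_ : [set _ | _] = [set: T] `&` e @^-1` `[eps, +oo[); first exact: me.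
by apply/seteqP; split => y /=; rewrite in_itv/= andbT => // -[].
Qed.

(** Dominated convergence along sequences decreasing to 0. Points with [e y <= 0] lie in no
    superlevel set [D eps], so the pointwise limit there is 0 and [G] has to vanish. *)
Lemma cvg_integral_superlevel (G : T -> R) : mu.-integrable setT (EFin \o G) ->
  (forall y, e y <= 0 -> G y = 0) ->
  (\int[mu]_(y in D eps) (G y)%:E)%E @[eps --> (0 : R)^'+] -->
  (\int[mu]_y (G y)%:E)%E.
Proof.
move=> iG G0.
have mG : measurable_fun setT (EFin \o G) by have /integrableP[] := iG.
have fG : (\int[mu]_y (G y)%:E)%E \is a fin_num by exact: integrable_fin_num.
rewrite -(fineK fG); apply/cvge_at_rightP => v [v0 vcvg]; rewrite (fineK fG).
under eq_cvg do rewrite integral_mkcond.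
have [|||||_ _ H] := @dominated_convergence _ T R mu setT measurableT
  (fun n => (EFin \o G) \_ (D (v n))) (EFin \o G) (abse \o (EFin \o G)).
- move=> n; apply/(measurable_restrictT _ (mD _)); exact: measurable_funTS.
- exact: mG.
- apply: aeW => y _ /=.
  have [ey|ey] := leP (e y) 0.
    rewrite G0//; rewrite (_ : (fun n => _) = cst 0%E); first exact: cvg_cst.
    by apply/funext => n; rewrite patchE; case: ifP => //= _; rewrite G0.
  apply: cvg_near_cst.
  move/cvgrPdist_lt : vcvg => /(_ _ ey); apply: filterS => n.
  rewrite sub0r normrN gtr0_norm// => ven.
  by rewrite patchE mem_set//=; exact: ltW.
- exact: integrable_abse.
- by apply: aeW => y n _ /=; rewrite patchE; case: ifP => // _; rewrite abse0.
exact: H.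
Qed.

Variables (rho : T -> T) (mrho : measurable_fun setT rho).
Hypothesis erho : forall y, e (rho y) = e y.
Hypothesis rho_inv : forall (B : set T) (f : T -> \bar R), measurable B ->
  measurable_fun B f -> (\int[mu]_(y in rho @^-1` B) f (rho y) = \int[mu]_(y in B) f y)%E.

(** Near the singularity [h] itself may fail to be integrable. Each [D eps] is invariant under
    [rho], so the truncated integral of [h] is half that of its symmetrization, which is integrable
    on the whole space. *)
Lemma cvg_integral_symmetrized (h g : T -> R) (r c : R) : 0 < r ->
  measurable_fun setT h ->
  (forall eps, 0 < eps -> mu.-integrable (D eps) (EFin \o h)) ->
  mu.-integrable setT (EFin \o g) ->
  (forall y, e y < r -> `|h y + h (rho y)| <= c * g y) ->
  (forall y, e y <= 0 -> h y + h (rho y) = 0) ->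
  mu.-integrable setT (EFin \o (fun y => h y + h (rho y))) /\
  (\int[mu]_(y in D eps) (h y)%:E)%E @[eps --> (0 : R)^'+] -->
  ((2^-1)%:E * \int[mu]_y (h y + h (rho y))%:E)%E.
Proof.
move=> r0 mh ih ig hg h0.
have Drho eps : rho @^-1` D eps = D eps by apply/seteqP; split => y /=; rewrite erho.
have mhr : measurable_fun setT (h \o rho) by exact: measurableT_comp.
have ihr eps : 0 < eps -> mu.-integrable (D eps) (EFin \o (h \o rho)).
  move=> eps0; have /integrableP[mhe hlt] := ih _ eps0.
  apply/integrableP; split; first by apply/measurable_EFinP; exact: measurable_funTS.
  rewrite -{1}(Drho eps) (rho_inv (f := fun y => `|(EFin \o h) y|%E))//.
  exact: measurableT_comp.
have iG : mu.-integrable setT (EFin \o (fun y => h y + h (rho y))).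
  pose G := EFin \o (fun y => h y + h (rho y)).
  pose C := [set y | e y < r].
  have mC : measurable C.
    rewrite (_ : C = ~` D r); first exact: measurableC.
    by apply/seteqP; split => y /=; rewrite /C/= ltNge => /negP.
  have iD : mu.-integrable setT (G \_ (D r)).
    apply: (integrable_mkcond G (mD r)).1.
    apply: (@eq_integrable _ _ _ mu _ (mD _) ((EFin \o h) \+ (EFin \o (h \o rho)))) => //.
    by apply: integrableD => //; [exact: ih|exact: ihr].
  have iC : mu.-integrable setT (G \_ C).
    apply: (integrable_mkcond G mC).1.
    exact: (integrable_le_cst mC (measurable_funD mh mhr) ig hg).
  apply: eq_integrable (integrableD measurableT iD iC) => // y _ /=.
  rewrite !patchE; have [ry|yr] := leP r (e y).
    rewrite mem_set//= memNset/= ?adde0// /C/= ltNge ry.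
    by move/negP.
  rewrite memNset/= ?mem_set//= ?add0e//.
  by rewrite leNgt yr => /negP.
split => //.
have := cvg_integral_superlevel iG h0 => /(cvgeZl (y := (2^-1)%:E)) => /(_ isT).
apply: cvg_trans; apply: near_eq_cvg; near=> eps.
have eps0 : 0 < eps by [].
under eq_integral do rewrite EFinD.
rewrite (@integralD _ _ _ mu _ (mD eps) (EFin \o h) (EFin \o (h \o rho)))//;
  [|exact: ih|exact: ihr].
rewrite -{2}(Drho eps) (rho_inv (f := EFin \o h))//; last first.
  by apply/measurable_EFinP; exact: measurable_funTS.
have /fineK <- : (\int[mu]_(y in D eps) (h y)%:E)%E \is a fin_num.
  by apply: integrable_fin_num => //; exact: ih.
by rewrite -EFinD -EFinM; congr EFin; lra.
Unshelve. all: by end_near. Qed.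

End abstract_principal_value.

(** * Weighted integrability and the space of admissible functions *)

Section weighted_L1.
Context d (T : measurableType d) {R : realType} (mu : {measure set T -> \bar R}).

Lemma weighted_integral_lty_le (w u f : T -> R) (c : R) : 0 <= c ->
  measurable_fun setT u -> measurable_fun setT f -> (forall x, 0 <= w x) ->
  mu.-integrable setT (EFin \o w) ->
  (\int[mu]_x (`|u x| * w x)%:E < +oo)%E -> (forall x, `|f x| <= `|u x| + c) ->
  (\int[mu]_x (`|f x| * w x)%:E < +oo)%E.
Proof.
move=> c0 mu_ mf w0 iw ulty fle.
have mw : measurable_fun setT w by apply/measurable_EFinP; have /integrableP[] := iw.
have mabs (g : T -> R) : measurable_fun setT g ->
    measurable_fun setT (fun x => (`|g x| * w x)%:E).
  by move=> mg; apply/measurable_EFinP; apply: measurable_funM => //; exact: measurableT_comp.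
have mcw : measurable_fun setT (fun x => (c * w x)%:E).
  by apply/measurable_EFinP; apply: measurable_funM.
apply: (@le_lt_trans _ _ (\int[mu]_x ((`|u x| * w x)%:E + (c * w x)%:E))%E).
  apply: ge0_le_integral => //.
  - by move=> x _; rewrite lee_fin mulr_ge0.
  - exact: mabs.
  - by apply: emeasurable_funD => //; exact: mabs.
  - by move=> x _; rewrite -EFinD lee_fin -mulrDl ler_wpM2r.
rewrite ge0_integralD//; last 3 first.
- by move=> x _; rewrite lee_fin mulr_ge0.
- exact: mabs.
- by move=> x _; rewrite lee_fin mulr_ge0.
apply: lte_add_pinfty => //.
under eq_integral do rewrite EFinM.
rewrite ge0_integralZl_EFin//; last 2 first.
- by move=> x _; rewrite lee_fin.
- exact/measurable_EFinP.
apply: lte_mul_pinfty => //.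
have /integrableP[_] := iw; congr (_ < _)%E; apply: eq_integral => x _ /=.
by rewrite ger0_norm.
Qed.

Lemma integrable_indic_lty (B : set T) : measurable B -> (mu B < +oo)%E ->
  mu.-integrable setT (EFin \o \1_B).
Proof.
move=> mB Blty; apply/integrableP; split.
  by apply/measurable_EFinP; exact: measurable_indic.
under eq_integral => x _ do rewrite /= ger0_norm//.
by rewrite integral_indic// setIT.
Qed.

Lemma integrable_weighted (w u : T -> R) : measurable_fun setT u -> measurable_fun setT w ->
  (forall x, 0 <= w x) ->
  (\int[mu]_x (`|u x| * w x)%:E < +oo)%E ->
  mu.-integrable setT (EFin \o (fun x => `|u x| * w x)).
Proof.
move=> mu_ mw w0 lty; apply/integrableP; split.
  by apply/measurable_EFinP; apply: measurable_funM => //; exact: measurableT_comp.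
move: lty; congr (_ < _)%E; apply: eq_integral => x _ /=.
by rewrite (ger0_norm (mulr_ge0 (normr_ge0 _) (w0 _))).
Qed.

End weighted_L1.

Definition sdiff (R : realType) (N : nat) (f : 'rV[R]_N -> R) (x y : 'rV[R]_N) : R :=
  f (x + y) + f (x - y) - 2 * f x.

Section principal_value.
Context {R : realType} {N : nat}.
Variables (s : R) (s0 : 0 < s) (s1 : s < 1).
Local Notation rV := 'rV[R]_N.
Local Notation lT := (lebesgue_row_type R N).
Local Notation mu := (@lebesgue_row R N).
Local Notation p := (N%:R + 2 * s).

Let p0 : 0 < p. Proof. by rewrite ltr_wpDl// mulr_gt0. Qed.

Definition omega (x : rV) : R := (1 + enorm x `^ p)^-1.

Lemma omega_ge0 x : 0 <= omega x.
Proof. by rewrite invr_ge0 addr_ge0// powR_ge0. Qed.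

Let omega_den_gt0 (x : rV) : 0 < 1 + enorm x `^ p.
Proof. by rewrite ltr_wpDr// powR_ge0. Qed.

Lemma measurable_omega : measurable_fun [set: lT] omega.
Proof.
have -> : omega = (fun r : R => r `^ (-1)) \o (fun x : rV => 1 + enorm x `^ p).
  by apply/funext => x /=; rewrite powR_inv1// ltW.
apply: (measurableT_comp (measurable_powR _)).
exact: (measurable_funD (measurable_cst _) (measurable_enorm_powR _)).
Qed.

(** The weight is at most 1 on the unit ball, which lies in the cube [B]; outside, it is at most
    |x|^(-p), which there is [levy_weight]. *)
Lemma integrable_omega : mu.-integrable setT (EFin \o omega).
Proof.
pose B := [set v : rV | forall i, `](- 1), 1[%classic (v ord0 i)].
have mB : measurable (B : set lT) by apply: (@measurable_box R N (fun=> `](- 1), 1[%classic)).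
have muB : (mu B < +oo)%E by rewrite (@lebesgue_row_cube R N _ _ 2)// ?ltry// => i; ring.
have iB := integrable_indic_lty mB muB.
have ilw := integrable_levy_weight s0 s1 (N := N).
have ig : mu.-integrable setT (EFin \o (fun x => \1_B x + levy_weight s x)).
  exact: (integrableD measurableT iB ilw).
apply: (@integrable_le_cst _ _ _ mu setT omega _ 1 measurableT measurable_omega ig).
move=> x _; rewrite mul1r ger0_norm ?omega_ge0//.
have [x1|x1] := ltP (enorm x) 1.
  rewrite ler_wpDr ?levy_weight_ge0// indicE mem_set/=; last first.
    by move=> i /=; rewrite in_itv/= -ltr_norml (le_lt_trans _ x1)// coord_le_enorm.
  by rewrite invf_le1// lerDl powR_ge0.
rewrite ler_wpDl// /levy_weight min_l ?mul1r; last by rewrite exprn_ege1.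
by rewrite lef_pV2 ?posrE// ?powR_gt0 ?(lt_le_trans _ x1)// lerDr.
Qed.

Lemma L1_omegaE (u : rV -> R) : L1_omega s u <->
  measurable_fun [set: lT] u /\ (\int[mu]_x (`|u x| * omega x)%:E < +oo)%E.
Proof. by []. Qed.

Lemma L1_omega_le (u f : rV -> R) (c : R) : 0 <= c -> L1_omega s u ->
  measurable_fun [set: lT] f -> (forall x, `|f x| <= `|u x| + c) -> L1_omega s f.
Proof.
move=> c0 [mu_ ulty] mf fle; split=> //.
exact: (weighted_integral_lty_le c0 mu_ mf omega_ge0 integrable_omega ulty fle).
Qed.

Lemma measurable_translate (f : rV -> R) (x : rV) : measurable_fun [set: lT] f ->
  measurable_fun [set: lT] (fun y : lT => f (x + y)).
Proof.
move=> mf.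
have -> : (fun y : rV => f (x + y)) = f \o row_shift false x.
  by apply/funext => y /=; rewrite /row_shift expr0 scale1r.
exact: (measurableT_comp mf (measurable_row_shift false x)).
Qed.

Lemma integrable_omega_translate (f : rV -> R) (x : rV) : L1_omega s f ->
  mu.-integrable setT (EFin \o (fun y => `|f (x + y)| * omega (x + y))).
Proof.
move=> /L1_omegaE[mf flty].
apply: (@integrable_weighted _ lT R mu (fun y => omega (x + y)) (fun y => f (x + y))
  (measurable_translate x mf) (measurable_translate x measurable_omega)
  (fun y => omega_ge0 _)).
have mg : measurable_fun [set: lT] (fun z => (`|f z| * omega z)%:E).
  apply/measurable_EFinP.
  apply: (measurable_funM _ measurable_omega).
  exact: (measurableT_comp (@normr_measurable R setT) mf).
have nng (z : lT) : [set: lT] z -> (0 <= (`|f z| * omega z)%:E)%E.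
  by move=> _; rewrite lee_fin mulr_ge0 ?omega_ge0.
have E := @ge0_integral_row_shift R false N x setT _ measurableT mg nng.
have -> : (\int[mu]_y (`|f (x + y)| * omega (x + y))%:E = \int[mu]_z (`|f z| * omega z)%:E)%E.
  rewrite -E preimage_setT; apply: eq_integral => y _.
  by rewrite /row_shift expr0 scale1r.
exact: flty.
Qed.

End principal_value.

Section principal_value_sdiff.
Context {R : realType} {N : nat}.
Variables (s lam Lam : R) (s0 : 0 < s) (s1 : s < 1) (lam0 : 0 < lam).
Local Notation rV := 'rV[R]_N.
Local Notation lT := (lebesgue_row_type R N).
Local Notation mu := (@lebesgue_row R N).
Local Notation p := (N%:R + 2 * s).
Variable K : rV -> R.
Hypothesis aK : admissible_kernel s lam Lam K.

Let p0 : 0 < p. Proof. by rewrite ltr_wpDl// mulr_gt0. Qed.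

Lemma kernel_gt0 y : y != 0 -> 0 < K y.
Proof.
move=> y0; have [_ _ /(_ _ y0)/andP[+ _]] := aK; apply: lt_le_trans.
by rewrite divr_gt0// powR_gt0// enorm_gt0.
Qed.

Lemma kernel_le y : y != 0 -> K y <= Lam / enorm y `^ p.
Proof. by move=> y0; have [_ _ /(_ _ y0)/andP[]] := aK. Qed.

Lemma kernel_ge y : y != 0 -> lam / enorm y `^ p <= K y.
Proof. by move=> y0; have [_ _ /(_ _ y0)/andP[]] := aK. Qed.

(** For |y| >= eps both parts of 1 + |x+y|^p are controlled by |y|^p: 1 <= eps^(-p) |y|^p, and |x+y|
    <= 2 (|x| + |y|) <= 2 (|x|/eps + 1) |y|. *)
Lemma enorm_tail_le (eps : R) (x y : rV) : 0 < eps -> eps <= enorm y ->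
  (enorm y `^ p)^-1 <=
    ((eps `^ p)^-1 + (2 * (enorm x / eps + 1)) `^ p) * omega s (x + y).
Proof.
move=> eps0 ey; have y0 : 0 < enorm y by exact: lt_le_trans ey.
have yp0 : 0 < enorm y `^ p by rewrite powR_gt0.
rewrite /omega -[leLHS]mul1r ler_pdivlMr ?ltr_wpDr ?powR_ge0//.
rewrite mul1r mulrC ler_pdivrMr// [leRHS]mulrDl.
apply: lerD.
  rewrite mulrC ler_pdivlMr ?powR_gt0// mul1r.
  by apply: ge0_ler_powR; rewrite ?nnegrE// ltW.
rewrite -powRM ?mulr_ge0 ?addr_ge0 ?divr_ge0 ?enorm_ge0// ?(ltW eps0)//.
apply: ge0_ler_powR; rewrite ?nnegrE ?(ltW p0) ?enorm_ge0 ?mulr_ge0 ?addr_ge0 ?divr_ge0 ?enorm_ge0//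
  ?(ltW eps0)//.
apply: le_trans (enormD_le2 _ _) _.
rewrite -mulrA ler_wpM2l// mulrDl mul1r lerD2r mulrAC ler_pdivlMr//.
by rewrite ler_wpM2l ?enorm_ge0.
Qed.

Lemma pv_operator_sdiff (f : rV -> R) (x : rV) (C r : R) : L1_omega s f -> 0 < r ->
  (forall y, enorm y < r -> `|sdiff f x y| <= C * enorm y ^+ 2) ->
  mu.-integrable setT (EFin \o (fun y => sdiff f x y * K y)) /\
  pv_operator K f x = ((2^-1)%:E * \int[mu]_y (sdiff f x y * K y)%:E)%E.
Proof.
move=> f1 r0 Cf.
have [mf _] := f1; have [mK Ksym _] := aK.
pose h (y : rV) := (f (x + y) - f x) * K y.
pose rho : lT -> lT := row_shift true (0 : rV).
have rhoE y : rho y = - y by rewrite /rho /row_shift expr1 scaleN1r add0r.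
(* A single dominating function: the first term controls f(x+y) at infinity, the second the constant
   f(x) at infinity and the quadratic behaviour at 0. *)
pose g (y : rV) := `|f (x + y)| * omega s (x + y) + levy_weight s y.
have ig : mu.-integrable setT (EFin \o g).
  exact: (integrableD measurableT (integrable_omega_translate x f1)
    (integrable_levy_weight s0 s1)).
have mh : measurable_fun [set: lT] h.
  apply: (measurable_funM _ mK).
  exact: (measurable_funB (measurable_translate x mf) (measurable_cst _)).
have hE y : h y + h (rho y) = sdiff f x y * K y.
  by rewrite /h rhoE -Ksym /sdiff; ring.
have normK (y : rV) : y != 0 -> `|K y| <= Lam / enorm y `^ p.
  by move=> y0; rewrite gtr0_norm ?kernel_gt0// kernel_le.
have aux (a q l o : R) : 0 <= a -> 0 <= q -> 0 <= l -> 0 <= o ->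
    a * o + q * l <= (a + q) * (o + l) by nra.
have ih eps : 0 < eps -> mu.-integrable [set y | eps <= enorm y] (EFin \o h).
  move=> eps0.
  (* For |y| >= eps the numerator of [levy_weight] is at least m. *)
  pose m := Num.min 1 (eps ^+ 2).
  have m0 : 0 < m by rewrite lt_min ltr01 exprn_gt0.
  pose A := (eps `^ p)^-1 + (2 * (enorm x / eps + 1)) `^ p.
  have A0 : 0 <= A by rewrite addr_ge0 ?invr_ge0 ?powR_ge0.
  apply: (@integrable_le_cst _ lT _ mu _ h g (`|Lam| * (A + `|f x| / m))
    (measurable_enorm_ge eps) mh ig) => y /= ey.
  have ey0 : 0 < enorm y by exact: lt_le_trans ey.
  have y0 : y != 0 by apply: contraTneq ey0 => ->; rewrite enorm0 ltxx.
  rewrite /h normrM.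
  apply: (@le_trans _ _ ((`|f (x + y)| + `|f x|) * (`|Lam| * (enorm y `^ p)^-1))).
    apply: ler_pM => //; first exact: ler_normB.
    by rewrite (le_trans (normK _ y0))// ler_wpM2r ?invr_ge0 ?powR_ge0// ler_norm.
  rewrite mulrCA -mulrA ler_wpM2l// mulrDl.
  have l0 := levy_weight_ge0 s y.
  have o0 : 0 <= `|f (x + y)| * omega s (x + y) by rewrite mulr_ge0 ?omega_ge0.
  have t1 : `|f (x + y)| * (enorm y `^ p)^-1 <= A * (`|f (x + y)| * omega s (x + y)).
    by rewrite mulrCA ler_wpM2l//; exact: enorm_tail_le.
  have t2 : `|f x| * (enorm y `^ p)^-1 <= `|f x| / m * levy_weight s y.
    rewrite -mulrA ler_wpM2l// [leRHS]mulrC ler_pdivlMr// [leLHS]mulrC /levy_weight.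
    rewrite ler_wpM2r ?invr_ge0 ?powR_ge0// le_min /m !ge_min lexx/=.
    by rewrite ler_pXn2r ?nnegrE ?(ltW eps0) ?enorm_ge0// ey orbT.
  have q0 : 0 <= `|f x| / m by rewrite divr_ge0// ltW.
  rewrite /g; apply: (le_trans (lerD t1 t2)).
  exact: aux.
have sd0 : sdiff f x 0 = 0 by rewrite /sdiff subr0 addr0; ring.
have hg y : enorm y < Num.min 1 r -> `|h y + h (rho y)| <= (`|C| * `|Lam|) * g y.
  rewrite lt_min => /andP[y1 yr]; rewrite hE.
  have [->|y0] := eqVneq y 0.
    rewrite sd0 mul0r normr0 mulr_ge0// ?mulr_ge0//.
    by rewrite addr_ge0 ?levy_weight_ge0// mulr_ge0 ?omega_ge0.
  apply: (@le_trans _ _ ((`|C| * enorm y ^+ 2) * (`|Lam| * (enorm y `^ p)^-1))).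
    rewrite normrM; apply: ler_pM => //.
      by rewrite (le_trans (Cf _ yr))// ler_wpM2r ?sqr_ge0// ler_norm.
    by rewrite (le_trans (normK _ y0))// ler_wpM2r ?invr_ge0 ?powR_ge0// ler_norm.
  rewrite mulrACA ler_wpM2l ?mulr_ge0// /g /levy_weight min_r.
    by rewrite ler_wpDl// mulr_ge0 ?omega_ge0.
  by rewrite exprn_ile1 ?enorm_ge0// ltW.
have h0 y : enorm y <= 0 -> h y + h (rho y) = 0.
  move=> y0; have -> : y = 0 by apply: enorm_eq0; apply/eqP; rewrite eq_le y0 enorm_ge0.
  by rewrite hE sd0 mul0r.
have min0 : 0 < Num.min 1 r by rewrite lt_min ltr01.
have erho y : enorm (rho y) = enorm y by rewrite rhoE enormN.
have [iG cG] := @cvg_integral_symmetrized _ lT R mu (@enorm R N) measurable_enorm rho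
  (measurable_row_shift true 0) erho (@integral_row_shift R true N 0) h g _ _ min0 mh ih ig hg h0.
have E : (fun y => h y + h (rho y)) = (fun y => sdiff f x y * K y).
  by apply/funext.
rewrite E in iG; split => //.
rewrite /pv_operator (cvg_lim _ cG)//.
by congr (_ * _)%E; apply: eq_integral => y _; rewrite hE.
Qed.
End principal_value_sdiff.

(** * The barrier *)

Section barrier_function.
Context {R : realType} {N : nat}.
Variables (s : R) (s0 : 0 < s).
Local Notation rV := 'rV[R]_N.
Local Notation lT := (lebesgue_row_type R N).
Local Notation p := (N%:R + 2 * s).

Let p0 : 0 < p. Proof. by rewrite ltr_wpDl// mulr_gt0. Qed.

Definition profile (r : R) : R := (1 + r ^+ 2) `^ (- (p / 2)).
Definition barrier (x : rV) : R := profile (enorm x).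

Let base_gt0 (r : R) : 0 < 1 + r ^+ 2.
Proof. by rewrite ltr_wpDr ?sqr_ge0. Qed.

Lemma profile_gt0 r : 0 < profile r.
Proof. by rewrite powR_gt0. Qed.

Lemma barrier_gt0 x : 0 < barrier x.
Proof. exact: profile_gt0. Qed.

Lemma profile_le r1 r2 : 0 <= r1 -> r1 <= r2 -> profile r2 <= profile r1.
Proof.
move=> r10 r12; rewrite /profile !powRN lef_pV2 ?posrE ?powR_gt0//.
apply: ge0_ler_powR; rewrite ?nnegrE ?divr_ge0 ?(ltW p0) ?(ltW (base_gt0 _))//.
by rewrite lerD2l ler_pXn2r ?nnegrE// (le_trans r10).
Qed.

Lemma profile_le1 r : 0 <= r -> profile r <= 1.
Proof.
move=> r0; apply: le_trans (profile_le (lexx 0) r0) _.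
by rewrite /profile expr0n/= addr0 powR1.
Qed.

Lemma barrier_le1 x : barrier x <= 1.
Proof. exact/profile_le1/enorm_ge0. Qed.

(** Since N >= 1 the exponent p/2 is at least 1/2, and (1 + r^2)^(1/2) >= r. This crude rate allows
    an explicit choice of the radius at the end. *)
Lemma profile_le_inv r : (1 <= N)%N -> 0 < r -> profile r <= r^-1.
Proof.
move=> N1 r0; rewrite /profile powRN lef_pV2 ?posrE ?powR_gt0//.
have b1 : 1 <= 1 + r ^+ 2 by rewrite lerDl sqr_ge0.
apply: (@le_trans _ _ ((1 + r ^+ 2) `^ 2^-1)).
  rewrite powR12_sqrt ?(ltW (base_gt0 _))// -[leLHS]ger0_norm ?(ltW r0)//.
  by rewrite -sqrtr_sqr ler_sqrt// ?lerDr// ltW.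
apply: ler_powR => //; rewrite ler_pdivlMr// mulVf// ler_wpDr// ?mulr_ge0 ?(ltW s0)//.
by rewrite -(ler_nat R) in N1.
Qed.

Lemma enorm_parallelogram (x y : rV) :
  enorm (x + y) ^+ 2 + enorm (x - y) ^+ 2 = 2 * (enorm x ^+ 2 + enorm y ^+ 2).
Proof.
rewrite !sqr_enorm -!big_split mulr_sumr; apply: eq_bigr => i _ /=.
by rewrite !mxE; ring.
Qed.

(** With (1 + t)^(-a) = exp(- a ln(1 + t)), use exp z >= 1 + z and ln(1 + t) <= t. *)
Lemma bernoulli_powRN (a t : R) : 0 <= a -> 0 <= t -> 1 - a * t <= (1 + t) `^ (- a).
Proof.
move=> a0 t0; rewrite /powR gt_eqF ?ltr_wpDr//.
apply: le_trans (expR_ge1Dx _); rewrite mulNr lerD2l lerN2 ler_wpM2l//.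
by rewrite le_ln1Dx// (lt_le_trans _ t0)// ltrN10.
Qed.

(* AM-GM twice: with q = 1 + |.|^2, b(x+y) + b(x-y) >= 2 (q(x+y) q(x-y))^(-p/4),
   and q(x+y) q(x-y) <= (q(x) + |y|^2)^2 by the parallelogram law. *)
Lemma sdiff_barrier_ge (x y : rV) :
  - (2 + p) * barrier x * Num.min 1 (enorm y ^+ 2) <= sdiff barrier x y.
Proof.
have [[bx0 bp0] bm0] := (barrier_gt0 x, barrier_gt0 (x + y), barrier_gt0 (x - y)).
(* Origin of the constant 2 + p: for |y| >= 1 dropping the two positive shifted values costs 2 b(x);
   for |y| < 1 the expansion costs p b(x) |y|^2. *)
have [y1|y1] := leP 1 (enorm y ^+ 2).
  have pb0 := mulr_gt0 p0 bx0.
  rewrite mulr1 /sdiff; move: pb0 bx0 bp0 bm0; clear.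
  move: (barrier x) (barrier (x + y)) (barrier (x - y)) => a b c; nra.
pose q (z : rV) := 1 + enorm z ^+ 2.
have q0 z : 0 < q z by exact: base_gt0.
have q1 z : 1 <= q z by rewrite lerDl sqr_ge0.
have qD : q (x + y) + q (x - y) = 2 * (q x + enorm y ^+ 2).
  have := enorm_parallelogram x y; rewrite /q; clear.
  by move: (enorm _ ^+ 2) (enorm _ ^+ 2) (enorm _ ^+ 2) (enorm _ ^+ 2) => a b c e; lra.
have split4 z : barrier z = q z `^ (- (p / 4)) ^+ 2.
  rewrite /barrier /profile -/(q z) -powR_mulrn ?powR_ge0// -powRrM.
  by congr (_ `^ _); field.
have sD : 2 * (q (x + y) * q (x - y)) `^ (- (p / 4)) <= barrier (x + y) + barrier (x - y).
  rewrite !split4 powRM ?(ltW (q0 _))//.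
  have := sqr_ge0 (q (x + y) `^ (- (p / 4)) - q (x - y) `^ (- (p / 4))).
  clear; move: (_ `^ _) (_ `^ _) => a b; nra.
have qM : q (x + y) * q (x - y) <= (q x + enorm y ^+ 2) ^+ 2.
  have := sqr_ge0 (q (x + y) - q (x - y)); move: qD.
  clear; move: (q (x + y)) (q (x - y)) (q x + enorm y ^+ 2) => a b c; nra.
have Q0 : 0 < q x + enorm y ^+ 2 by rewrite ltr_wpDr ?sqr_ge0.
have powM : (q x + enorm y ^+ 2) `^ (- (p / 2)) <= (q (x + y) * q (x - y)) `^ (- (p / 4)).
  have -> : - (p / 2) = 2%:R * (- (p / 4)) by field.
  rewrite powRrM powR_mulrn ?(ltW Q0)// !powRN lef_pV2 ?posrE ?powR_gt0 ?mulr_gt0 ?exprn_gt0//.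
  by apply: ge0_ler_powR; rewrite ?nnegrE ?mulr_ge0 ?divr_ge0 ?(ltW p0) ?exprn_ge0
    ?(ltW (q0 _)) ?(ltW Q0).
have t0 : 0 <= enorm y ^+ 2 / q x by rewrite divr_ge0 ?sqr_ge0 ?(ltW (q0 _)).
have powB : barrier x * (1 - p / 2 * enorm y ^+ 2) <= (q x + enorm y ^+ 2) `^ (- (p / 2)).
  have -> : q x + enorm y ^+ 2 = q x * (1 + enorm y ^+ 2 / q x).
    by rewrite mulrDr mulr1 mulrCA divff ?mulr1// gt_eqF.
  rewrite powRM; [|exact/ltW/q0|exact: addr_ge0].
  rewrite -[q x `^ _]/(barrier x) ler_wpM2l ?(ltW bx0)//.
  apply: le_trans (bernoulli_powRN _ t0); rewrite ?divr_ge0 ?(ltW p0)//.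
  rewrite lerD2l lerN2 ler_wpM2l ?divr_ge0 ?(ltW p0)//.
  by rewrite ler_pdivrMr// ler_peMr ?sqr_ge0.
have e0 := sqr_ge0 (enorm y).
have : 0 <= barrier x * enorm y ^+ 2 by rewrite mulr_ge0 ?(ltW bx0).
rewrite /sdiff; move: sD powM powB p0 bx0.
move: (enorm y ^+ 2) (barrier x) (_ `^ _) (_ `^ _) => e b c d.
move: (barrier _) (barrier _) => f g; move: (p) => P.
nra.
Qed.

Lemma measurable_barrier : measurable_fun [set: lT] barrier.
Proof.
have -> : barrier = (fun r : R => r `^ (- (p / 2))) \o (fun x : rV => 1 + enorm x ^+ 2).
  by [].
apply: (measurableT_comp (measurable_powR _)).
exact: (measurable_funD (measurable_cst _) (measurable_funX _ measurable_enorm)).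
Qed.

Lemma continuous_barrier : continuous barrier.
Proof.
have -> : barrier = (fun x : rV => expR (- (p / 2) * ln (1 + enorm x ^+ 2))).
  by apply/funext => x; rewrite /barrier /profile /powR gt_eqF.
move=> x.
have c1 : {for x, continuous (fun x : rV => 1 + enorm x ^+ 2)}.
  apply: continuousD; first exact: cst_continuous.
  apply: (@continuous_comp _ _ _ (@enorm R N) (fun a => a ^+ 2)); last exact: exprn_continuous.
  exact: continuous_enorm.
have c2 : {for x, continuous (@ln R \o (fun x : rV => 1 + enorm x ^+ 2))}.
  by apply: continuous_comp => //; exact: continuous_ln.
have c3 : {for x, continuous (fun x : rV => - (p / 2) * ln (1 + enorm x ^+ 2))}.
  by apply: continuousM; first exact: cst_continuous.
apply: (continuous_comp c3); exact: continuous_expR.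
Qed.

End barrier_function.
Arguments profile {R} N s r.

(** * Comparison of nonlocal operators *)

Section abstract_comparison.
Context d (T : measurableType d) {R : realType} (mu : {measure set T -> \bar R}).

Lemma le_integral_indic (F G w : T -> R) (B : set T) (m alpha beta : R) :
  mu.-integrable setT (EFin \o F) -> mu.-integrable setT (EFin \o G) ->
  mu.-integrable setT (EFin \o w) -> measurable B -> mu B = m%:E ->
  (forall y, F y + (alpha * \1_B y - beta * w y) <= G y) ->
  (\int[mu]_y (F y)%:E +
    (alpha * m - beta * fine (\int[mu]_y (w y)%:E))%:E <= \int[mu]_y (G y)%:E)%E.
Proof.
move=> iF iG iw mB muB FG.
have iB : mu.-integrable setT (EFin \o \1_B).
  by apply: integrable_indic_lty => //; rewrite muB ltry.
have iaB : mu.-integrable setT (fun y => alpha%:E * (EFin \o \1_B) y)%E by exact: integrableZl.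
have ibw : mu.-integrable setT (fun y => beta%:E * (EFin \o w) y)%E by exact: integrableZl.
have iFb := integrableB measurableT iaB ibw.
have fw : (\int[mu]_y (w y)%:E)%E \is a fin_num by exact: integrable_fin_num.
have <- : (\int[mu]_y ((F y)%:E + (alpha%:E * (EFin \o \1_B) y - beta%:E * (EFin \o w) y)) =
    \int[mu]_y (F y)%:E + (alpha * m - beta * fine (\int[mu]_y (w y)%:E))%:E)%E.
  rewrite (@integralD _ _ _ mu _ measurableT (EFin \o F) _ iF iFb).
  congr (_ + _)%E; rewrite (@integralB _ _ _ mu _ measurableT _ _ iaB ibw).
  rewrite !integralZl// integral_indic// setIT muB.
  by rewrite EFinB !EFinM fineK.
apply: le_integral => //; first exact: (integrableD measurableT iF iFb).
by move=> y _; rewrite /= -!EFinM -EFinB -EFinD lee_fin.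
Qed.

End abstract_comparison.

Section comparison.
Context {R : realType} {N : nat}.
Variables (s lam Lam : R) (s0 : 0 < s) (s1 : s < 1) (lam0 : 0 < lam).
Local Notation rV := 'rV[R]_N.
Local Notation lT := (lebesgue_row_type R N).
Local Notation mu := (@lebesgue_row R N).
Local Notation p := (N%:R + 2 * s).

Let p0 : 0 < p. Proof. by rewrite ltr_wpDl// mulr_gt0. Qed.

(** Exactly what turns the principal value at x into an integral of second differences; test
    functions of class C^2 near x satisfy it. *)
Definition pv_regular (f : rV -> R) (x : rV) : Prop :=
  L1_omega s f /\ exists C r, 0 < r /\
    forall y, enorm y < r -> `|sdiff f x y| <= C * enorm y ^+ 2.

Definition tail_const (rho : R) : R := (((2 * rho) ^+ 2 * 2) `^ (p / 2))^-1.

Lemma tail_const_gt0 rho : 0 < rho -> 0 < tail_const rho.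
Proof. by move=> r0; rewrite invr_gt0 powR_gt0// !mulr_gt0// exprn_gt0// mulr_gt0. Qed.

Definition levy_mass : R := fine (\int[mu]_y (levy_weight s y)%:E)%E.

Definition open_cube (a : 'I_N -> R) (l : R) : set rV :=
  [set v | forall i, `]a i, (a i + l)[%classic (v ord0 i)].

(** Integrated form of a second-difference excess of c on a cube of side l, minus t b(x) min(1,
    |y|^2). The excess meets the lower kernel bound, the loss the upper one; 1/2 comes from the
    formula with second differences. *)
Definition gain (x : rV) (t c l rho : R) : R :=
  2^-1 * barrier s x * (c * lam * tail_const rho * l ^+ N - t * Lam * levy_mass).

(** Here |y| <= 2 (rho + |x|) <= 2 rho (1 + |x|) because rho >= 1, and (1 + |x|)^2 <= 2 (1 + |x|^2).
    So |y|^2 is at most 2 (2 rho)^2 (1 + |x|^2), whose power - p/2 is [tail_const rho] times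
    b(x). *)
Lemma kernel_ge_barrier (K : rV -> R) (x y : rV) (rho : R) :
  admissible_kernel s lam Lam K -> y != 0 -> 1 <= rho -> enorm (x + y) <= rho ->
  lam * tail_const rho * barrier s x <= K y.
Proof.
move=> aK y0 rho1 xyr; apply: le_trans (kernel_ge aK y0).
have ey0 := enorm_gt0 y0; have x0 := enorm_ge0 x.
have rho0 : 0 < rho by rewrite (lt_le_trans _ rho1).
rewrite -mulrA ler_wpM2l ?(ltW lam0)// /barrier /profile powRN /tail_const -invfM.
rewrite lef_pV2 ?posrE ?mulr_gt0 ?powR_gt0 ?mulr_gt0 ?exprn_gt0 ?mulr_gt0 ?ltr_wpDr ?sqr_ge0//.
rewrite -powRM; [|by rewrite mulr_ge0 ?sqr_ge0|by rewrite addr_ge0 ?sqr_ge0].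
have -> : enorm y `^ p = (enorm y ^+ 2) `^ (p / 2).
  by rewrite -powR_mulrn ?(ltW ey0)// -powRrM; congr (_ `^ _); field.
apply: ge0_ler_powR; rewrite ?nnegrE ?sqr_ge0 ?divr_ge0 ?(ltW p0)//.
  by rewrite mulr_ge0 ?addr_ge0 ?sqr_ge0// mulr_ge0 ?sqr_ge0.
have : enorm y <= 2 * (rho + enorm x).
  have -> : y = (x + y) + - x by rewrite addrAC subrr add0r.
  apply: le_trans (enormD_le2 _ _) _; rewrite enormN ler_wpM2l// lerD2r//.
move=> ey.
have ey2 : enorm y ^+ 2 <= (2 * (rho + enorm x)) ^+ 2.
  by apply: lerXn2r => //; rewrite nnegrE ?(ltW ey0) ?mulr_ge0 ?addr_ge0 ?(ltW rho0).
apply: le_trans ey2 _.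
have h1 : rho + enorm x <= rho * (1 + enorm x).
  by rewrite mulrDr mulr1 lerD2l ler_peMl.
have h2 : (rho + enorm x) ^+ 2 <= (rho * (1 + enorm x)) ^+ 2.
  by apply: lerXn2r => //; rewrite nnegrE ?mulr_ge0 ?addr_ge0 ?(ltW rho0).
have h3 : (1 + enorm x) ^+ 2 <= 2 * (1 + enorm x ^+ 2).
  by have := sqr_ge0 (1 - enorm x); move: (enorm x) => e; nra.
rewrite !exprMn -[leRHS]mulrA -[leRHS]mulrA; apply: ler_wpM2l; first exact: sqr_ge0.
by apply: le_trans h2 _; rewrite exprMn ler_wpM2l ?sqr_ge0.
Qed.

Lemma open_cube_measure (x : rV) a l : 0 <= l ->
  measurable ([set y | open_cube a l (x + y)] : set lT) /\
  mu [set y | open_cube a l (x + y)] = (l ^+ N)%:E.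
Proof.
move=> l0.
have -> : [set y | open_cube a l (x + y)] =
    [set v : rV | forall i, `](a i - x ord0 i), (a i - x ord0 i + l)[%classic (v ord0 i)].
  apply/seteqP; split => v h i; have := h i; rewrite /= !in_itv/= ?mxE => /andP[? ?];
    by apply/andP; split; lra.
split.
  exact: (@measurable_box R N (fun i => `](a i - x ord0 i), (a i - x ord0 i + l)[%classic)).
by rewrite (@lebesgue_row_cube R N _ _ l)// => i; rewrite addrAC subrr add0r.
Qed.

Lemma pv_operator_compare K (f g : rV -> R) (x : rV) a (t c l rho : R) :
  admissible_kernel s lam Lam K -> pv_regular f x -> pv_regular g x ->
  0 <= t -> 0 <= c -> 0 <= l -> 1 <= rho ->
  open_cube a l `<=` [set v | enorm v <= rho] ->
  (forall y, c * \1_(open_cube a l) (x + y) - t * barrier s x * Num.min 1 (enorm y ^+ 2)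
    <= sdiff g x y - sdiff f x y) ->
  (pv_operator K f x + (gain x t c l rho)%:E <= pv_operator K g x)%E.
Proof.
move=> aK [f1 [Cf [rf [rf0 hf]]]] [g1 [Cg [rg [rg0 hg]]]] t0 c0 l0 rho1 Srho fg.
have [iF ->] := pv_operator_sdiff s0 s1 lam0 aK f1 rf0 hf.
have [iG ->] := pv_operator_sdiff s0 s1 lam0 aK g1 rg0 hg.
have [mB muB] := open_cube_measure x a l0.
pose B := [set y | open_cube a l (x + y)].
have bx0 := barrier_gt0 s x.
have E y : \1_B y = \1_(open_cube a l) (x + y) :> R.
  by rewrite !indicE; congr (nat_of_bool _)%:R; apply/idP/idP; rewrite !inE.
have FG y : sdiff f x y * K y + ((c * lam * tail_const rho * barrier s x) * \1_B y
    - (t * barrier s x * Lam) * levy_weight s y) <= sdiff g x y * K y.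
  (* At y = 0 the kernel is uncontrolled, but both second differences vanish there and the
     hypothesis forces c times the indicator at x to be at most 0. *)
  have [->|y0] := eqVneq y 0.
    have sd0 h : sdiff h x 0 = 0 by rewrite /sdiff subr0 addr0; ring.
    have := fg 0; rewrite !sd0 enorm0 expr0n/= min_r// mulr0 subrr subr0.
    rewrite !mul0r add0r /levy_weight enorm0 expr0n/= min_r// mul0r mulr0 subr0.
    rewrite E => cle; have tc0 : 0 <= lam * tail_const rho * barrier s x.
      by rewrite !mulr_ge0 ?(ltW lam0) ?(ltW bx0) ?(ltW (tail_const_gt0 _)) ?(lt_le_trans _ rho1).
    have -> : c * lam * tail_const rho * barrier s x * \1_(open_cube a l) (x + 0) =
      lam * tail_const rho * barrier s x * (c * \1_(open_cube a l) (x + 0)) by ring.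
    exact: mulr_ge0_le0.
  have Ky0 := kernel_gt0 lam0 aK y0.
  rewrite E -lerBrDl -mulrBl.
  apply: le_trans (ler_wpM2r (ltW Ky0) (fg y)).
  rewrite mulrBl; apply: lerB.
    rewrite indicE; case: (boolP (x + y \in _)) => h; last by rewrite !mulr0 mul0r.
    rewrite !mulr1 -!mulrA ler_wpM2l// mulrA.
    apply: (kernel_ge_barrier aK y0 rho1); apply: Srho; by rewrite inE in h.
  rewrite /levy_weight -!mulrA ler_wpM2l// ler_wpM2l ?(ltW bx0)//.
  rewrite [leRHS]mulrCA ler_wpM2l ?le_min ?ler01 ?sqr_ge0//.
  exact: kernel_le aK _ y0.
have := le_integral_indic iF iG (integrable_levy_weight s0 s1) mB muB FG.
rewrite -/levy_mass => h.
have h2 : (0 <= (2^-1 : R)%:E)%E by rewrite lee_fin invr_ge0.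
apply: le_trans (lee_wpmul2l h2 h).
move: (\int[mu]_y (sdiff f x y * K y)%:E)%E => J.
rewrite muleDr ?fin_num_adde_defl //
  -EFinM leeD2l// lee_fin /gain.
by rewrite le_eqVlt; apply/orP; left; apply/eqP; ring.
Qed.

(** The only property of [I] that the main argument uses. It does not mention the family of kernels,
    so suprema, infima and the dual operator are treated alike. *)
Definition pv_comparison (I : (rV -> R) -> rV -> \bar R) : Prop :=
  I (cst 0) = cst 0%E /\
  forall f g x a (t c l rho : R), pv_regular f x -> pv_regular g x ->
  0 <= t -> 0 <= c -> 0 <= l -> 1 <= rho ->
  open_cube a l `<=` [set v | enorm v <= rho] ->
  (forall y, c * \1_(open_cube a l) (x + y) - t * barrier s x * Num.min 1 (enorm y ^+ 2)
    <= sdiff g x y - sdiff f x y) ->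
  (I f x + (gain x t c l rho)%:E <= I g x)%E.

Lemma pv_operator0 (K : rV -> R) : pv_operator K (cst 0) = cst 0%E.
Proof.
apply/funext => x; rewrite /pv_operator.
under eq_fun => eps do under eq_integral => y _ do rewrite subrr mul0r.
under eq_fun => eps do rewrite integral0.
exact: lim_cst.
Qed.

Section extremal.
Variables (A : Type) (hA : inhabited A) (L : A -> (rV -> R) -> rV -> \bar R).
Hypothesis hL : forall a, class_L s lam Lam (L a).

Let L_compare al f g x a (t c l rho : R) : pv_regular f x -> pv_regular g x ->
  0 <= t -> 0 <= c -> 0 <= l -> 1 <= rho ->
  open_cube a l `<=` [set v | enorm v <= rho] ->
  (forall y, c * \1_(open_cube a l) (x + y) - t * barrier s x * Num.min 1 (enorm y ^+ 2)
    <= sdiff g x y - sdiff f x y) ->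
  (L al f x + (gain x t c l rho)%:E <= L al g x)%E.
Proof. by have [K aK ->] := hL al; exact: pv_operator_compare. Qed.

Let L0 al x : L al (cst 0) x = 0%E.
Proof. by have [K aK ->] := hL al; rewrite pv_operator0. Qed.

(** The gain is finite and independent of the index, so it passes through the supremum. An index
    must exist for I(0) = 0, the empty supremum being -oo. *)
Lemma sup_pv_comparison (I : (rV -> R) -> rV -> \bar R) :
  (forall u x, I u x = ereal_sup [set L a u x | a in [set: A]]) -> pv_comparison I.
Proof.
move=> hI; split.
  apply/funext => x; rewrite hI; case: hA => al.
  rewrite (_ : [set _ | _ in _] = [set 0%E]) ?ereal_sup1//.
  by apply/seteqP; split => [_ [b _ <-]|_ ->] /=; [exact: L0|exists al].
move=> f g x a t c l rho h1 h2 h3 h4 h5 h6 h7 h8; rewrite !hI -leeBrDr//.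
apply: ge_ereal_sup => _ [al _ <-]; rewrite leeBrDr//.
apply: le_trans (L_compare al h1 h2 h3 h4 h5 h6 h7 h8) _.
by apply: ereal_sup_ubound; exists al.
Qed.

Lemma inf_pv_comparison (I : (rV -> R) -> rV -> \bar R) :
  (forall u x, I u x = ereal_inf [set L a u x | a in [set: A]]) -> pv_comparison I.
Proof.
move=> hI; split.
  apply/funext => x; rewrite hI; case: hA => al.
  rewrite (_ : [set _ | _ in _] = [set 0%E]) ?ereal_inf1//.
  by apply/seteqP; split => [_ [b _ <-]|_ ->] /=; [exact: L0|exists al].
move=> f g x a t c l rho h1 h2 h3 h4 h5 h6 h7 h8; rewrite !hI.
apply: le_ereal_inf_tmp => _ [al _ <-].
apply: le_trans (L_compare al h1 h2 h3 h4 h5 h6 h7 h8).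
by apply: leeD2r; apply: ereal_inf_lbound; exists al.
Qed.
End extremal.

(** Second differences are odd in the function, so the comparison is applied to - g and - f in
    exchanged roles. *)
Lemma pv_comparisonN (I : (rV -> R) -> rV -> \bar R) : pv_comparison I ->
  pv_comparison (fun f x => - I (\- f)%R x)%E.
Proof.
move=> [I0 hI]; split.
  apply/funext => x; rewrite (_ : \- _ = cst 0) ?I0 ?oppe0//.
  by apply/funext => y /=; rewrite oppr0.
have sdN f x y : sdiff (\- f) x y = - sdiff f x y by rewrite /sdiff/=; ring.
have regN f x : pv_regular f x -> pv_regular (\- f) x.
  move=> [f1 [C [r [r0 hf]]]]; split.
    apply: (L1_omega_le s0 s1 (lexx 0) f1).
      exact: (measurable_funN f1.1).
    by move=> y; rewrite normrN addr0.
  by exists C, r; split=> // y yr; rewrite sdN normrN; exact: hf.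
move=> f g x a t c l rho rf rg t0 c0 l0 rho1 hS hfg.
have hgf y : c * \1_(open_cube a l) (x + y) - t * barrier s x * Num.min 1 (enorm y ^+ 2)
    <= sdiff (\- f) x y - sdiff (\- g) x y.
  by rewrite !sdN opprK [leRHS]addrC; exact: hfg.
have := hI _ _ _ a t c l rho (regN _ _ rg) (regN _ _ rf) t0 c0 l0 rho1 hS hgf.
by rewrite leeNr oppeD ?fin_num_adde_defl// oppeK leeBrDr.
Qed.

End comparison.

(** * Functions of class C^k *)

Section mean_value.
Context {R : realType}.

(** The mean value theorem is applied to t -> g(t y) on [0, 1], which spares the case distinction on
    the sign of y. *)
Lemma le_mean_value_norm (g : R -> R) (c m y : R) :
  (forall t, `|t| <= `|y| -> derivable g t 1 /\ `|'D_1 g t - c| <= m) ->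
  `|g y - g 0 - c * y| <= m * `|y|.
Proof.
move=> dg; pose h t := g (t * y).
have dh (t : R) : t \in `[0, 1] -> is_derive t 1 h ('D_1 g (t * y) * y).
  rewrite in_itv/= => /andP[t0 t1].
  have ty : `|t * y| <= `|y| by rewrite normrM ger0_norm// ler_piMl.
  have [d1 _] := dg _ ty.
  have dm : is_derive t 1 (fun t => t * y) y.
    rewrite (_ : (fun t => t * y) = y \*: id); last by apply/funext => z; rewrite /= mulrC.
    by apply: is_derive_eq; rewrite -[RHS]mulr1.
  have := @is_derive1_comp R g (fun t => t * y) t _ _ (derivableP d1) dm.
  by rewrite mulrC.
have ch : {within `[0, 1], continuous h}.
  by apply: derivable_within_continuous => t /dh[].
have dh' (t : R) : t \in `]0, 1[ -> is_derive t 1 h ('D_1 g (t * y) * y).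
  by move=> t01; apply: dh; apply: subset_itv_oo_cc.
have [t t01] := MVT ltr01 dh' ch.
rewrite /h mul1r mul0r subr0 mulr1 => ->.
rewrite -mulrBl normrM ler_wpM2r//.
have [] // := dg (t * y).
move: t01; rewrite in_itv/= => /andP[t0 t1].
by rewrite normrM ger0_norm ?ler_piMl// ltW.
Qed.

Context {N : nat}.
Local Notation rV := 'rV[R]_N.
Local Notation e_ i := (delta_mx ord0 i : rV).

(** Vertices of the staircase from x to x + y along the coordinate axes. Moving along it involves
    partial derivatives only, which is all that [Ck_on] provides. *)
Let clip (x y : rV) (k : nat) : rV := \row_i (x ord0 i + if (i < k)%N then y ord0 i else 0).

Lemma derive_line (f : rV -> R) (w v : rV) (t : R) :
  derivable f (w + t *: v) v ->
  derivable (fun t : R => f (w + t *: v)) t 1 /\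
  'D_1 (fun t : R => f (w + t *: v)) t = 'D_v f (w + t *: v).
Proof.
move=> df.
have E : (fun h : R => h^-1 *: (f (w + (h *: 1 + t) *: v) - f (w + t *: v))) =
    (fun h : R => h^-1 *: (f (h *: v + (w + t *: v)) - f (w + t *: v))).
  apply/funext => h; congr (_ *: (f _ - _)).
  by rewrite scalerDl [_ *: 1]mulr1 addrCA.
by rewrite /derivable /derive E.
Qed.

Lemma le_mean_value_coord (f : rV -> R) (c : 'I_N -> R) (m : R) (x y : rV) :
  0 <= m ->
  (forall z, `|z - x| <= `|y| -> forall i,
     derivable f z (e_ i) /\ `|'D_(e_ i) f z - c i| <= m) ->
  `|f (x + y) - f x - \sum_i c i * y ord0 i| <= N%:R * m * `|y|.
Proof.
move=> m0 df.
have yi i : `|y ord0 i| <= `|y|.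
  by rewrite [leRHS]/Num.norm/= mx_normrE; apply/bigmax_geP; right; exists (ord0, i).
have clip0 : clip x y 0 = x by apply/rowP => i; rewrite mxE addr0.
have clipN : clip x y N = x + y by apply/rowP => i; rewrite !mxE ltn_ord.
have clipS (i : 'I_N) : clip x y i.+1 = clip x y i + y ord0 i *: e_ i.
  apply/rowP => j; rewrite !mxE eqxx/=; have [->|ij] := eqVneq j i.
    by rewrite ltnSn ltnn addr0 mulr1.
  rewrite mulr0 addr0 ltnS leq_eqVlt; case: eqVneq => // ji.
  by move: ij; rewrite -val_eqE/= ji eqxx.
have -> : f (x + y) - f x - \sum_i c i * y ord0 i =
    \sum_(i < N) (f (clip x y i.+1) - f (clip x y i) - c i * y ord0 i).
  rewrite sumrB; congr (_ - _).
  rewrite -(big_mkord xpredT (fun i => f (clip x y i.+1) - f (clip x y i))).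
  by rewrite telescope_sumr// clip0 clipN.
apply: le_trans (ler_norm_sum _ _ _) _.
rewrite -mulrA mulr_natl -[X in _ *+ X]card_ord -sumr_const; apply: ler_sum => i _.
apply: (@le_trans _ _ (m * `|y ord0 i|)); last by rewrite ler_wpM2l.
rewrite clipS.
have := @le_mean_value_norm (fun t : R => f (clip x y i + t *: e_ i)) (c i) m (y ord0 i).
rewrite scale0r addr0; apply => t ty.
have zy : `|clip x y i + t *: e_ i - x| <= `|y|.
  rewrite [leLHS]/Num.norm/= mx_normrE; apply/bigmax_leP; split => // -[a j] _ /=.
  rewrite (ord1 a) !mxE eqxx/= addrAC [_ + _ - x _ _]addrAC subrr add0r.
  have [->|ij] := eqVneq j i; first by rewrite ltnn add0r mulr1 (le_trans ty).
  by rewrite mulr0 addr0; case: ifP => // _; rewrite normr0.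
have [d1 d2] := df _ zy i.
by have [? ->] := derive_line d1.
Qed.

Lemma Ck_on_at k (U : set rV) (f : rV -> R) x : open U -> U x -> Ck_on k U f ->
  {for x, continuous f}.
Proof.
move=> oU Ux; case: k => [|k] [cf _]; move: cf; rewrite continuous_open_subspace//;
  by apply; rewrite inE.
Qed.

(** Bounded second partials make the gradient Lipschitz near x, hence f(x+y) differs from its affine
    part by O(|y|^2); the linear terms for y and - y cancel. *)
Lemma C2_sdiff_le (U : set rV) (f : rV -> R) (x : rV) : open U -> U x -> Ck_on 2 U f ->
  exists C r, 0 < r /\ forall y, enorm y < r -> `|sdiff f x y| <= C * enorm y ^+ 2.
Proof.
move=> oU Ux [_ df].
pose D2 i j := 'D_(e_ j) ('D_(e_ i) f).
have cD2 i j : {for x, continuous (D2 i j)}.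
  by have [_ [_ /(_ j)[_ ck]]] := df i; exact: (@Ck_on_at 0 U (D2 i j) x oU Ux ck).
(* The largest second partial at x, plus 1 as room for continuity nearby. *)
pose M := \big[Num.max/0]_(ij : 'I_N * 'I_N) `|D2 ij.1 ij.2 x| + 1.
have M0 : 0 <= M by rewrite addr_ge0//; apply/bigmax_geP; left.
have : \forall z \near x, U z /\ forall ij : 'I_N * 'I_N, `|D2 ij.1 ij.2 z| <= M.
  near=> z; split; first by near: z; exact: open_nbhs_nbhs.
  near: z; apply: filter_forall => -[i j] /=.
  have /cvgrPdist_lt /(_ 1 ltr01) := cD2 i j; apply: filterS => z zx.
  rewrite -[D2 i j z](subrK (D2 i j x)) (le_trans (ler_normD _ _))// /M addrC.
  apply: lerD; last by rewrite distrC ltW.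
  by apply/bigmax_geP; right; exists (i, j).
move=> /nbhs_ballP[r r0 Hr].
have near_x z : `|z - x| < r -> U z /\ forall i j, `|D2 i j z| <= M.
  move=> zr; have [] := Hr z; first by rewrite -ball_normE/= distrC.
  by move=> Uz h; split=> // i j; exact: (h (i, j)).
have grad z i : `|z - x| < r -> `|'D_(e_ i) f z - 'D_(e_ i) f x| <= N%:R * M * `|z - x|.
  move=> zr; have := @le_mean_value_coord ('D_(e_ i) f) (fun=> 0) M x (z - x) M0.
  rewrite [x + (z - x)]addrC subrK big1 ?subr0; last by move=> j _; rewrite mul0r.
  apply=> w wz j; have [Uw hw] := near_x w (le_lt_trans wz zr).
  have [_ [_ /(_ j)[dd _]]] := df i.
  by split; [exact: dd|rewrite subr0; exact: hw].
have half y : `|y| < r ->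
    `|f (x + y) - f x - \sum_i 'D_(e_ i) f x * y ord0 i| <= N%:R * (N%:R * M * `|y|) * `|y|.
  move=> yr; apply: le_mean_value_coord; first by rewrite !mulr_ge0.
  move=> z zy i; have zr := le_lt_trans zy yr; have [Uz _] := near_x _ zr.
  split; first by have [d _] := df i; exact: d.
  by rewrite (le_trans (grad z i zr))// ler_wpM2l// mulr_ge0.
exists (2 * (N%:R ^+ 2 * M)), r; split=> // y yr.
have yr' : `|y| < r := le_lt_trans (mxnorm_le_enorm y) yr.
have h1 := half y yr'.
have := half (- y); rewrite normrN => /(_ yr') h2.
have -> : sdiff f x y = (f (x + y) - f x - \sum_i 'D_(e_ i) f x * y ord0 i) +
   (f (x - y) - f x - \sum_i 'D_(e_ i) f x * (- y) ord0 i).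
  have -> : \sum_i 'D_(e_ i) f x * (- y) ord0 i = - \sum_i 'D_(e_ i) f x * y ord0 i.
    by rewrite -sumrN; apply: eq_bigr => i _; rewrite mxE mulrN.
  by rewrite /sdiff; ring.
apply: le_trans (ler_normD _ _) _; apply: le_trans (lerD h1 h2) _.
have : `|y| ^+ 2 <= enorm y ^+ 2.
  by rewrite lerXn2r ?nnegrE ?enorm_ge0 ?mxnorm_le_enorm.
move=> h; have := ler_wpM2l (mulr_ge0 (sqr_ge0 (N%:R : R)) M0) h.
rewrite !expr2; lra.
Unshelve. all: by end_near. Qed.

End mean_value.

(** * Algebra of C^k functions *)

Section Ck_calculus.
Context {R : realType} {N : nat}.
Local Notation rV := 'rV[R]_N.
Local Notation e_ i := (delta_mx ord0 i : rV).
Implicit Types (U : set rV) (f g : rV -> R).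

Lemma within_openP U f : open U ->
  {within U, continuous f} <-> (forall x, U x -> {for x, continuous f}).
Proof.
move=> oU; rewrite continuous_open_subspace//; split => [h x Ux|h x /set_mem]; last exact: h.
by apply: h; rewrite inE.
Qed.

Lemma Ck_on_subset k U U' f : open U -> open U' -> U' `<=` U -> Ck_on k U f -> Ck_on k U' f.
Proof.
move=> oU oU' UU'; elim: k f => [|k IH] f /= [cf df]; split=> //.
- exact: continuous_subspaceW cf.
- exact: continuous_subspaceW cf.
- by move=> i; have [d1 d2] := df i; split=> [x /UU'|]; [exact: d1|exact: IH].
Qed.

(** Derivatives are total functions, and the calculus rules identify them only on [U]; this
    congruence lets such formulas be substituted at every order. *)
Lemma Ck_on_eq k U f g : open U -> (forall x, U x -> f x = g x) -> Ck_on k U f -> Ck_on k U g.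
Proof.
move=> oU.
have near_fg (f1 g1 : rV -> R) x : (forall x, U x -> f1 x = g1 x) -> U x ->
    {near x, f1 =1 g1}.
  by move=> fg Ux; apply: filterS (open_nbhs_nbhs (conj oU Ux)) => z; exact: fg.
have cont (f1 g1 : rV -> R) : (forall x, U x -> f1 x = g1 x) ->
    {within U, continuous f1} -> {within U, continuous g1}.
  move=> fg /(within_openP _ oU) cf; apply/(within_openP _ oU) => x Ux.
  have gx : g1 @ x --> f1 x.
    apply: cvg_trans (cf _ Ux).
    by apply: (@near_eq_cvg _ _ (nbhs x) _ f1 g1); exact: near_fg.
  by rewrite (fg _ Ux) in gx.
elim: k f g => [|k IH] f g fg /= [cf df]; split=> //.
- exact: cont cf.
- exact: cont cf.
- move=> i; have [d1 d2] := df i; split=> [x Ux|].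
    by apply: near_eq_derivable (d1 _ Ux); exact: near_fg.
  apply: IH d2 => x Ux; apply: near_eq_derive; exact: near_fg.
Qed.

Lemma Ck_onW k U f : Ck_on k.+1 U f -> Ck_on k U f.
Proof.
elim: k f => [|k IH] f /= [cf df]; split=> //.
by move=> i; have [d1 d2] := df i; split=> //; exact: IH d2.
Qed.

Lemma Ck_on_cst k U (c : R) : Ck_on k U (cst c).
Proof.
have cc (a : R) : {within U, continuous (cst a : rV -> R)}.
  by apply: continuous_subspaceT => x; exact: cst_continuous.
elim: k c => [|k IH] c; split => // i; split=> [x _|]; first exact: derivable_cst.
rewrite (_ : 'D_ _ _ = cst 0); first exact: IH.
by apply/funext => x; rewrite derive_cst.
Qed.

Lemma Ck_onD k U f g : open U -> Ck_on k U f -> Ck_on k U g -> Ck_on k U (fun x => f x + g x).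
Proof.
move=> oU; have cont (f1 g1 : rV -> R) : {within U, continuous f1} -> {within U, continuous g1} ->
    {within U, continuous (fun x => f1 x + g1 x)}.
  move=> /(within_openP _ oU) cf /(within_openP _ oU) cg; apply/(within_openP _ oU) => x Ux.
  exact: (continuousD (cf _ Ux) (cg _ Ux)).
elim: k f g => [|k IH] f g /= [cf df] [cg dg]; split=> //; try exact: cont.
- move=> i; have [d1 d2] := df i; have [d3 d4] := dg i; split=> [x Ux|].
    exact: (derivableD (d1 _ Ux) (d3 _ Ux)).
  apply: Ck_on_eq (IH _ _ d2 d4) => // x Ux.
  by rewrite -(deriveD (d1 _ Ux) (d3 _ Ux)).
Qed.

Lemma Ck_onM k U f g : open U -> Ck_on k U f -> Ck_on k U g -> Ck_on k U (fun x => f x * g x).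
Proof.
move=> oU; have cont (f1 g1 : rV -> R) : {within U, continuous f1} -> {within U, continuous g1} ->
    {within U, continuous (fun x => f1 x * g1 x)}.
  move=> /(within_openP _ oU) cf /(within_openP _ oU) cg; apply/(within_openP _ oU) => x Ux.
  exact: (continuousM (cf _ Ux) (cg _ Ux)).
elim: k f g => [|k IH] f g /= => [[cf _] [cg _]|]; first by split=> //; exact: cont.
move=> hf hg; have f1 : Ck_on k.+1 U f by [].
have g1 : Ck_on k.+1 U g by [].
move: hf hg => [cf df] [cg dg]; split; first exact: cont.
move=> i; have [d1 d2] := df i; have [d3 d4] := dg i; split=> [x Ux|].
  exact: (derivableM (d1 _ Ux) (d3 _ Ux)).
apply: Ck_on_eq (Ck_onD oU (IH _ _ (Ck_onW f1) d4) (IH _ _ (Ck_onW g1) d2)) => // x Ux.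
by rewrite -[RHS]/('D_(e_ i) (f * g) x) (deriveM (d1 _ Ux) (d3 _ Ux)).
Qed.

Lemma Ck_on_coord k U (i : 'I_N) : open U -> Ck_on k U (fun x => x ord0 i).
Proof.
move=> oU; have cc : {within U, continuous (fun x : rV => x ord0 i)}.
  by apply: continuous_subspaceT => x; exact: coord_continuous.
case: k => [|k]; first by split.
split=> // j.
have dE x : is_derive x (e_ j) (fun x : rV => x ord0 i) (i == j)%:R.
  have E : (fun h : R => h^-1 *: ((h *: e_ j + x) ord0 i - x ord0 i)) @ (0 : R)^' -->
      ((i == j)%:R : R).
    apply: cvg_near_cst; near=> h.
    rewrite !mxE eqxx/= addrK -[_ *: _]/(h^-1 * (h * _)) mulKf//.
    by near: h; exact: nbhs_dnbhs_neq.
  apply: DeriveDef; first by apply/cvg_ex; exists ((i == j)%:R).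
  exact: cvg_lim E.
split=> [x _|]; first by have [] := dE x.
rewrite (_ : 'D_ _ _ = cst ((i == j)%:R : R)); first exact: Ck_on_cst.
by apply/funext => x; have [_ ->] := dE x.
Unshelve. all: by end_near. Qed.

(** The derivative is a q^(a-1) times a partial of q, so the induction on k must let the exponent
    vary. Positivity of q keeps the power smooth. *)
Lemma Ck_on_powR k U (q : rV -> R) (a : R) : open U -> (forall x, U x -> 0 < q x) ->
  (forall k, Ck_on k U q) -> Ck_on k U (fun x => q x `^ a).
Proof.
move=> oU q0 hq.
have dpow (b : R) x i : U x -> is_derive x (e_ i) (fun x => q x `^ b)
    (b * q x `^ (b - 1) * 'D_(e_ i) q x).
  move=> Ux; have [_ /(_ i)[/(_ x Ux) dq _]] := hq 1%N.
  (* The chain rule is reduced to one variable by restricting to the line through x in direction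
     e_i. *)
  pose h (t : R) := q (t *: e_ i + x).
  have line (g : rV -> R) :
      (fun t : R => t^-1 *: (g ((t *: 1 + 0) *: e_ i + x) - g (0 *: e_ i + x))) =
      (fun t : R => t^-1 *: (g (t *: e_ i + x) - g x)).
    by apply/funext => t; rewrite scale0r add0r addr0 [_ *: 1]mulr1.
  have dh : is_derive (0 : R) (1 : R) h ('D_(e_ i) q x).
    apply: DeriveDef; first exact: (derivable1P _ _ _).1.
    by rewrite /derive (line q).
  have h0 : 0 < h 0 by rewrite /h scale0r add0r; exact: q0.
  have [d1 d2] := @is_derive1_comp R (fun r => r `^ b) h 0 _ _ (is_derive1_powR b h0) dh.
  apply: DeriveDef; first exact/derivable1P.
  move: d2; rewrite {2}/h scale0r add0r => <-.
  by rewrite /derive (line (fun x => q x `^ b)).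
have cpow (b : R) : {within U, continuous (fun x => q x `^ b)}.
  apply/(within_openP _ oU) => x Ux.
  have cq : {for x, continuous q} := Ck_on_at oU Ux (hq 0%N).
  apply: (@continuous_comp _ _ _ q (fun r => r `^ b) x cq).
  apply: differentiable_continuous; apply/derivable1_diffP.
  by have [] := is_derive1_powR b (q0 _ Ux).
elim: k a => [|k IH] a; first by split.
split; first exact: cpow.
move=> i; split=> [x Ux|]; first by have [] := dpow a x i Ux.
have [_ /(_ i)[_ dqk]] := hq k.+1.
apply: Ck_on_eq (Ck_onM oU (Ck_onM oU (Ck_on_cst k U a) (IH (a - 1))) dqk) => // x Ux.
by have [_ ->] := dpow a x i Ux.
Qed.

Lemma Ck_on_sum k U (n : nat) (P : pred 'I_n) (F : 'I_n -> rV -> R) : open U ->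
  (forall i, Ck_on k U (F i)) -> Ck_on k U (fun x => \sum_(i < n | P i) F i x).
Proof.
move=> oU hF; elim: (index_enum _) => [|i r IH].
  apply: Ck_on_eq (Ck_on_cst k U 0) => // x _; by rewrite big_nil.
have [Pi|Pi] := boolP (P i).
  by apply: Ck_on_eq (Ck_onD oU (hF i) IH) => // x _; rewrite big_cons Pi.
by apply: Ck_on_eq IH => // x _; rewrite big_cons (negbTE Pi).
Qed.

End Ck_calculus.

(** * Balls *)

Section ball_domain.
Context {R : realType} {N : nat}.
Local Notation rV := 'rV[R]_N.
Variables (r : R) (r0 : 0 < r).
Let G : set rV := [set x | enorm x < r].

Let open_lt_pre (f : rV -> R) (c : R) : continuous f -> open [set x | f x < c].
Proof.
move=> cf; rewrite (_ : [set _ | _] = f @^-1` [set t | t < c])//.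
by apply: open_comp => [x _|]; [exact: cf|exact: open_lt].
Qed.

(** The ball is star-shaped: a union of segments through the origin. *)
Let connectedG : connected G.
Proof.
have -> : G = \bigcup_(x in G) ((fun t : R => t *: x) @` `[0, 1]%classic).
  apply/seteqP; split => [x Gx|y [x Gx [t]]].
    by exists x => //; exists 1; [rewrite /= in_itv/= ler01 lexx|rewrite scale1r].
  rewrite /= in_itv/= => /andP[t0 t1] <-; rewrite /G/= enormZ ger0_norm//.
  by apply: le_lt_trans Gx; rewrite ler_piMl ?enorm_ge0.
apply: bigcup_connected.
  by exists 0 => x Gx; exists 0; [rewrite /= in_itv/= lexx ler01|rewrite scale0r].
move=> x Gx; apply: connected_continuous_connected; first exact: segment_connected.
apply: continuous_subspaceT => t; exact: scalel_continuous.
Qed.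

Let boundary_eq x0 : (closure G `\` interior G) x0 -> enorm x0 = r.
Proof.
have oG : open G by apply: open_lt_pre; exact: continuous_enorm.
have iG : interior G = G by apply/interior_id.
move=> [cl]; rewrite iG /G/= => /negP; rewrite -leNgt => rx.
apply/eqP; rewrite eq_le rx andbT leNgt; apply/negP => xr.
have oC : open [set x : rV | - enorm x < - r].
  by apply: open_lt_pre => x; apply: continuousN; exact: continuous_enorm.
have [|x [/= h1 h2]] := cl [set x | - enorm x < - r].
  by apply: open_nbhs_nbhs; split=> //=; rewrite ltrN2.
by move: h2; rewrite ltrN2 ltNge (ltW h1).
Qed.

Lemma bounded_C2_domain_ball : bounded_C2_domain G.
Proof.
split; [|by apply: open_lt_pre; exact: continuous_enorm|exact: connectedG| |].
- by exists 0; rewrite /G/= enorm0.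
- exists r; split; first exact: num_real.
  by move=> M rM x /= Gx; rewrite (le_trans (mxnorm_le_enorm _))// ltW// (lt_trans Gx).
move=> x0 /boundary_eq x0r.
have [i xi] : exists i, x0 ord0 i != 0.
  apply: contrapT => /forallNP h; move: r0; rewrite -x0r.
  rewrite (_ : x0 = 0) ?enorm0 ?ltxx//; apply/rowP => i.
  by rewrite mxE; apply/eqP; have /negP := h i; rewrite negbK.
(* The sign makes the relabelled coordinate negative at x0, so that near x0 the ball lies above the
   lower hemisphere - sqrt q, as the epigraph form of [C2_boundary] demands. *)
pose b := 0 < x0 ord0 i.
pose sg : R := (-1) ^+ b.
have sgx0 : sg * x0 ord0 i < 0.
  rewrite /sg /b; case: (ltP 0 (x0 ord0 i)) => xi0; first by rewrite /= ?expr1 mulN1r oppr_lt0.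
  by rewrite /= ?expr0 mul1r lt_neqAle xi xi0.
pose q (x : rV) := r ^+ 2 - \sum_(j < N | j != i) x ord0 j ^+ 2.
have qE (x : rV) : enorm x ^+ 2 = x ord0 i ^+ 2 + r ^+ 2 - q x.
  by rewrite sqr_enorm (bigD1 i)//= /q; ring.
have Ckq U k : open U -> Ck_on k U q.
  move=> oU.
  have CkS : Ck_on k U (fun x : rV => \sum_(j < N | j != i) x ord0 j ^+ 2).
    apply: Ck_on_sum => // j.
    exact: Ck_on_eq (Ck_onM oU (Ck_on_coord k j oU) (Ck_on_coord k j oU)).
  apply: Ck_on_eq (Ck_onD oU (Ck_on_cst k U (r ^+ 2))
    (Ck_onM oU (Ck_on_cst k U (-1)) CkS)) => // x _.
  by rewrite /q /cst mulN1r.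
have cq : continuous q.
  by move=> x; apply: (@Ck_on_at R N 0 setT) => //; [exact: openT|apply: Ckq; exact: openT].
(* Positivity of q makes its square root smooth; the sign condition permits squaring the epigraph
   inequality. *)
pose U := [set x : rV | - q x < 0] `&` [set x : rV | sg * x ord0 i < 0].
have oU : open U.
  apply: openI; apply: open_lt_pre.
    by move=> x; apply: continuousN; exact: cq.
  move=> x; exact: (continuousM (@cst_continuous _ _ sg x) (@coord_continuous R 1 N ord0 i x)).
have q0 x : U x -> 0 < q x by move=> [/=]; rewrite oppr_lt0.
exists U, i, b, (fun x => -1 * q x `^ 2^-1); split.
- split => //; split => //=; rewrite oppr_lt0.
  have -> : q x0 = x0 ord0 i ^+ 2 by have := qE x0; rewrite x0r; lra.
  by rewrite exprn_even_gt0.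
- move=> x y xy; rewrite /q; congr (-1 * (_ - _) `^ _).
  by apply: eq_bigr => j ji; rewrite xy.
- apply: Ck_onM => //; first exact: Ck_on_cst.
  by apply: Ck_on_powR => // k; exact: Ckq.
move=> x Ux; have qx := q0 _ Ux; have [_ /= sgx] := Ux.
rewrite powR12_sqrt ?(ltW qx)// mulN1r ltrNl -/sg.
have sg2 : (- (sg * x ord0 i)) ^+ 2 = x ord0 i ^+ 2.
  by rewrite sqrrN exprMn /sg sqrr_sign mul1r.
have -> : (- (sg * x ord0 i) < Num.sqrt (q x)) = (x ord0 i ^+ 2 < q x).
  rewrite -sg2 -[in RHS](sqr_sqrtr (ltW qx)) ltr_pXn2r// nnegrE ?sqrtr_ge0//.
  by rewrite oppr_ge0 ltW.
rewrite /G/= -(ltr_pXn2r (n := 2))// ?nnegrE ?enorm_ge0 ?(ltW r0)// qE.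
by split; lra.
Qed.

End ball_domain.

(** * The main argument *)

Section duality.
Context {R : realType} {N : nat}.
Local Notation rV := 'rV[R]_N.
Variable s : R.
Variable I : (rV -> R) -> rV -> \bar R.

Definition dual_operator (f : rV -> R) (x : rV) : \bar R := (- I (\- f)%R x)%E.

Let opprfK (f : rV -> R) : \- (\- f) = f.
Proof. by apply/funext => x /=; rewrite opprK. Qed.

Let Ck_onN k U (f : rV -> R) : open U -> Ck_on k U f -> Ck_on k U (\- f).
Proof.
move=> oU hf; apply: Ck_on_eq (Ck_onM oU (Ck_on_cst k U (-1)) hf) => // x _ /=.
by rewrite mulN1r.
Qed.

Lemma L1_omegaN (f : rV -> R) : L1_omega s f -> L1_omega s (\- f).
Proof.
move=> [mf flty]; split; first exact: measurable_funN.
by under eq_integral do rewrite normrN.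
Qed.

Lemma supersolution_dual (Omega : set rV) (V u : rV -> R) :
  viscosity_supersolution s I Omega V (cst 0) u ->
  viscosity_subsolution s dual_operator Omega V (cst 0) (\- u).
Proof.
move=> [lsc u1 test]; split.
- rewrite /usc_on (_ : (fun _ => _) = (fun x : subspace Omega => (u x)%:E))//.
  by apply/funext => x /=; rewrite opprK.
- exact: L1_omegaN.
move=> x Nx psi oN Nxx NO psi1 psi2 psix upsi.
have := test x Nx (\- psi) oN Nxx NO (L1_omegaN psi1) (Ck_onN oN psi2).
rewrite /= psix /= opprK => /(_ erefl)/(_ _)/wrap[y|].
  by rewrite -[leRHS]opprK lerN2; exact: upsi.
rewrite /dual_operator; case: (I _ _) => [r| |]//=.
by rewrite -!EFinD !lee_fin; lra.
Qed.

Lemma subsolution_dual (Omega : set rV) (V u : rV -> R) :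
  viscosity_subsolution s dual_operator Omega V (cst 0) u ->
  viscosity_supersolution s I Omega V (cst 0) (\- u).
Proof.
move=> [usc u1 test]; split; [exact: usc|exact: L1_omegaN|].
move=> x Nx phi oN Nxx NO phi1 phi2 phix uphi.
have := test x Nx (\- phi) oN Nxx NO (L1_omegaN phi1) (Ck_onN oN phi2).
rewrite /= phix /= opprK => /(_ erefl)/(_ _)/wrap[y|].
  by rewrite -[leLHS]opprK lerN2; exact: uphi.
rewrite /dual_operator opprfK; case: (I _ _) => [r| |]//=.
by rewrite -!EFinD !lee_fin; lra.
Qed.

Lemma minimum_principle_dual (V : rV -> R) (G : set rV) :
  minimum_principle s I V G -> maximum_principle s dual_operator V G.
Proof.
move=> hmin v usc v1 hv vout x; rewrite -oppr_ge0.
have vout' y : ~ G y -> 0 <= (\- v) y by move=> /vout; rewrite oppr_ge0.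
exact: (hmin (\- v) usc (L1_omegaN v1) (subsolution_dual hv) vout' x).
Qed.

End duality.

Lemma continuous_usc_on (R : realType) (N : nat) (A : set 'rV[R]_N) (v : 'rV[R]_N -> R) :
  continuous v -> usc_on A v.
Proof.
move=> cv.
have cA : {within A, continuous (\- v)}.
  by apply: continuous_subspaceT => x; apply: continuousN; exact: cv.
move=> x a; rewrite lte_fin => ax.
exists [set y | a < - v y]; last by move=> y /=; rewrite lte_fin.
exact: (cvgr_gt _ (cA x) _ ax).
Qed.

(** * Nonpositivity of decaying subsolutions *)

Section one_sided_bound.
Context {R : realType} {N : nat}.
Local Notation rV := 'rV[R]_N.
Local Notation lT := (lebesgue_row_type R N).
Variables (s lam Lam : R) (s0 : 0 < s) (s1 : s < 1) (lam0 : 0 < lam) (Lam0 : 0 <= Lam).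
Hypothesis N1 : (1 <= N)%N.
Local Notation p := (N%:R + 2 * s).
Local Notation b := (barrier s).
Variables (I : (rV -> R) -> rV -> \bar R) (V u : rV -> R) (B : R).
Hypothesis hI : pv_comparison s lam Lam I.
Hypothesis VB : forall x, `|V x| <= B.
Hypothesis hmax : forall r, 0 < r -> maximum_principle s I V [set x | enorm x < r].
Hypothesis cu : continuous u.
Hypothesis u1 : L1_omega s u.
Hypothesis hu : viscosity_subsolution s I setT V (cst 0) u.
Hypothesis hdecay : forall e, 0 < e ->
  exists M, forall x, M < enorm x -> u x <= e * b x.

Let p0 : 0 < p. Proof. by rewrite ltr_wpDl// mulr_gt0. Qed.

Let B0 : 0 <= B. Proof. exact: le_trans (VB 0). Qed.

Let W0 : 0 <= levy_mass (N := N) s.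
Proof.
by rewrite fine_ge0// integral_ge0// => y _; rewrite lee_fin levy_weight_ge0.
Qed.

Let lee_test (X : \bar R) (r w : R) : (r%:E <= X)%E -> 0 <= r + w -> (0 <= X + w%:E)%E.
Proof.
by case: X => [a| |]//=; rewrite ?leey// -EFinD !lee_fin; lra.
Qed.

Let pv_regular_cst0 x : pv_regular s (cst 0 : rV -> R) x.
Proof.
split.
  apply: (L1_omega_le s0 s1 (lexx 0) u1) => [|y]; first exact: measurable_cst.
  by rewrite normr0 addr0.
exists 0, 1; split=> // y _; rewrite /sdiff/= mulr0 subr0 addr0 normr0 mul0r//.
Qed.

Let pv_regular_C2 (U : set rV) f x : open U -> U x -> Ck_on 2 U f -> L1_omega s f ->
  pv_regular s f x.
Proof. by move=> oU Ux f2 f1; split=> //; exact: C2_sdiff_le oU Ux f2. Qed.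

Let W := levy_mass (N := N) s.

Let competitor (eps kappa : R) (x : rV) : R := Num.max (u x) (eps * b x) - kappa.

Let competitor_continuous eps kappa : continuous (competitor eps kappa).
Proof.
move=> x; apply: (@continuousB _ _ _ (fun x => Num.max (u x) (eps * b x)) (cst kappa)).
  apply: continuous_max; first exact: cu.
  exact: (continuousM (@cst_continuous _ _ eps x) (@continuous_barrier R N s x)).
exact: cst_continuous.
Qed.

Let competitor_L1 eps kappa : 0 <= eps -> 0 <= kappa -> L1_omega s (competitor eps kappa).
Proof.
move=> e0 k0; apply: (L1_omega_le s0 s1 (addr_ge0 e0 k0) u1).
  apply: (measurable_funB _ (measurable_cst _)).
  apply: (measurable_maxr u1.1).
  exact: (measurable_funM (measurable_cst _) (measurable_barrier s)).
move=> x; rewrite /competitor.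
have bx0 := barrier_gt0 s x; have bx1 := barrier_le1 s0 x.
have eb0 : 0 <= eps * b x by rewrite mulr_ge0// ltW.
have eb1 : eps * b x <= eps by rewrite ler_piMr.
apply: le_trans (ler_normB _ _) _; rewrite addrA.
apply: lerD; last by rewrite ger0_norm.
case: (leP (u x) (eps * b x)) => h; last by rewrite lerDl.
by rewrite ger0_norm// ler_wpDl.
Qed.

(* The test function touches [competitor] where the barrier is active. *)
Let barrier_active (x : rV) (psi : rV -> R) (a : 'I_N -> R) (eps kappa c l rho : R) :
  pv_regular s psi x -> 0 <= eps -> 0 <= c -> 0 <= l -> 1 <= rho ->
  open_cube a l `<=` [set v | enorm v <= rho] ->
  (forall z, open_cube a l z -> eps * b z + c <= u z) ->
  (forall z, competitor eps kappa z <= psi z) -> psi x = eps * b x - kappa ->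
  ((gain s lam Lam x (eps * (2 + p)) c l rho)%:E <= I psi x)%E.
Proof.
move=> rpsi e0 c0 l0 rho1 Srho hS vpsi psix.
have [I0 cmp] := hI.
have t0 : 0 <= eps * (2 + p) by rewrite mulr_ge0// addr_ge0// ltW.
(* Comparison with the zero function, where [I] vanishes: the barrier enters only through its
   pointwise second-difference bound. *)
suff main y : c * \1_(open_cube a l) (x + y) - eps * (2 + p) * b x * Num.min 1 (enorm y ^+ 2)
    <= sdiff psi x y - sdiff (cst 0) x y.
  have := cmp _ _ x a _ c l rho (pv_regular_cst0 x) rpsi t0 c0 l0 rho1 Srho main.
  by rewrite I0 /= add0e.
have -> : sdiff (cst 0) x y = 0 by rewrite /sdiff/= mulr0 subr0 addr0.
rewrite subr0.
have pp : eps * b (x + y) - kappa + c * \1_(open_cube a l) (x + y) <= psi (x + y).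
  apply: le_trans (vpsi _); rewrite /competitor addrAC lerD2r indicE.
  case: (boolP (x + y \in _)) => h; last by rewrite mulr0 addr0 le_max lexx orbT.
  by rewrite mulr1 le_max hS//; rewrite inE in h.
have pm : eps * b (x - y) - kappa <= psi (x - y).
  by apply: le_trans (vpsi _); rewrite /competitor lerD2r le_max lexx orbT.
have := ler_wpM2l e0 (sdiff_barrier_ge s0 x y).
move: pp pm; rewrite /sdiff psix.
move: (psi _) (psi _) (b _) (b _) (b _) (\1_ _ _) (Num.min _ _) => P1 P2 b1 b2 b3 i m.
lra.
Qed.

(* The test function touches [competitor] where [u] is active.  Lowering it on a far cube, where
   the barrier exceeds [u], gives a test function for [u] itself. *)
Let u_active (x : rV) (U : set rV) (psi : rV -> R) (a : 'I_N -> R) (eps kappa delta l rho : R) :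
  open U -> U x -> Ck_on 2 U psi -> L1_omega s psi ->
  (forall z, U z -> ~ open_cube a l z) ->
  0 <= kappa -> 0 <= delta -> 0 <= l -> 1 <= rho ->
  open_cube a l `<=` [set v | enorm v <= rho] ->
  (forall z, open_cube a l z -> u z + delta <= eps * b z) ->
  (forall z, competitor eps kappa z <= psi z) -> psi x = u x - kappa ->
  ((gain s lam Lam x 0 delta l rho - V x * u x)%:E <= I psi x)%E.
Proof.
move=> oU Ux psi2 psi1 Ucube k0 d0 l0 rho1 Srho hS vpsi psix.
pose C := open_cube a l.
(* Adding [kappa] undoes the shift in [competitor], so [psi'] touches [u] at x. It stays C^2 on [U]
   because [U] misses the cube. *)
pose psi' (z : rV) := psi z + (kappa - delta * \1_C z).
have ind0 z : U z -> \1_C z = 0 :> R by move=> /Ucube h; rewrite indicE memNset.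
have mC : measurable (C : set lT).
  exact: (@measurable_box R N (fun i => `]a i, (a i + l)[%classic)).
have psi'1 : L1_omega s psi'.
  apply: (L1_omega_le s0 s1 (addr_ge0 k0 d0) psi1).
    apply: (measurable_funD psi1.1); apply: (measurable_funB (measurable_cst _)).
    exact: (measurable_funM (measurable_cst _) (measurable_indic mC)).
  move=> z; apply: le_trans (ler_normD _ _) _; rewrite lerD2l.
  apply: le_trans (ler_normB _ _) _; rewrite ger0_norm// lerD2l normrM ger0_norm//.
  by rewrite indicE; case: (_ \in _); rewrite ?normr1 ?normr0 ?mulr1 ?mulr0.
have psi'2 : Ck_on 2 U psi'.
  apply: Ck_on_eq (Ck_onD oU psi2 (Ck_on_cst 2 U kappa)) => // z Uz.
  by rewrite /psi' ind0// mulr0 subr0.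
have psi'x : psi' x = u x by rewrite /psi' ind0// mulr0 subr0 psix subrK.
have upsi' z : u z <= psi' z.
  have := vpsi z; rewrite /competitor lerBlDr => h.
  rewrite /psi' addrA indicE; case: (boolP (z \in C)) => zC.
    rewrite mulr1 lerBrDr; apply: le_trans (hS z _) _; first by rewrite inE in zC.
    by apply: le_trans h; rewrite le_max lexx orbT.
  by rewrite mulr0 subr0; apply: le_trans h; rewrite le_max lexx.
have [_ _ /(_ x U psi' oU Ux (fun _ _ => Logic.I) psi'1 psi'2 psi'x upsi')] := hu.
have [_ cmp] := hI.
(* The constant [kappa] cancels and x is off the cube, so the difference is delta times the
   indicators at x + y and x - y; the second is dropped. There is no loss term, hence t = 0. *)
have main y : delta * \1_C (x + y) - 0 * b x * Num.min 1 (enorm y ^+ 2)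
    <= sdiff psi x y - sdiff psi' x y.
  have i0 : 0 <= \1_C (x - y) :> R by rewrite indicE.
  rewrite !mul0r subr0 /sdiff /psi' (ind0 x Ux) mulr0 subr0.
  have := mulr_ge0 d0 i0.
  by move: (psi _) (psi _) (psi _) (\1_C (x - y)) (\1_C (x + y)) => P1 P2 P3 i1 i2; lra.
have := cmp psi' psi x a 0 delta l rho (pv_regular_C2 oU Ux psi'2 psi'1)
  (pv_regular_C2 oU Ux psi2 psi1) (lexx 0) d0 l0 rho1 Srho main.
move: (I psi' x) (I psi x) => J1 J2 /[swap].
rewrite /cst; case: J1 => [r1| |]; case: J2 => [r2| |]//=; rewrite ?leey// -!EFinD !lee_fin; lra.
Qed.

Lemma viscosity_subsolution_le0 x : u x <= 0.
Proof.
rewrite leNgt; apply/negP; move: x => x0 ux0.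
(* The quarters are spent as follows: u >= 2 m on a cube around x0 and eps b <= m leave an excess m
   there, while eps <= m keeps the competitor positive at x0. *)
pose m := u x0 / 4.
have m0 : 0 < m by rewrite divr_gt0.
have b0 (z : rV) : 0 < b z := barrier_gt0 s z.
have b1 (z : rV) : b z <= 1 := barrier_le1 s0 z.
have [l l0 near_u] : exists2 l, 0 < l & forall z, `|z - x0| < l -> 2 * m <= u z.
  have /cvgrPdist_lt /(_ _ m0) := @cu x0; move=> /nbhs_ballP[l l0 h].
  exists l => // z zl; have := h z; rewrite -ball_normE/= distrC => /(_ zl).
  by rewrite ltr_norml => /andP[_]; rewrite /m; lra.
pose a i := x0 ord0 i - l / 2.
have cube_near z : open_cube a l z -> `|z - x0| < l.
  move=> zS; have : `|z - x0| <= l / 2.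
    rewrite [leLHS]/Num.norm/= mx_normrE; apply/bigmax_leP; split => [|[k i] _ /=].
      by rewrite divr_ge0// ltW.
    rewrite (ord1 k) !mxE; have := zS i; rewrite /= in_itv/= /a ler_norml => /andP[? ?].
    by apply/andP; split; lra.
  by move=> /le_lt_trans; apply; rewrite ltr_pdivrMr//; lra.
pose rho := 1 + N%:R * (`|x0| + l).
have rho1 : 1 <= rho by rewrite lerDl mulr_ge0// addr_ge0// ltW.
have Srho : open_cube a l `<=` [set v | enorm v <= rho].
  move=> z zS /=; apply: le_trans (enorm_le_mxnorm z) _.
  rewrite /rho ler_wpDl// ler_wpM2l//.
  rewrite -[z](subrK x0) addrC (le_trans (ler_normD _ _))// lerD2l ltW//.
  exact: cube_near.
pose c3 := m * lam * tail_const (N := N) s rho * l ^+ N.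
have c30 : 0 < c3.
  rewrite !mulr_gt0 ?exprn_gt0// tail_const_gt0// (lt_le_trans _ rho1)//.
pose C1 := (2 + p) * Lam * W.
have C10 : 0 <= C1 by rewrite !mulr_ge0// addr_ge0// ltW.
(* [C1] accounts for the loss of the barrier, 2 B for the zero-order term outside the common factor
   1/2; the 1 makes D positive. *)
pose D := C1 + 2 * B + 1.
have D0 : 0 < D by rewrite ltr_wpDl// addr_ge0// mulr_ge0.
pose eps := Num.min m (c3 / D).
have eps0 : 0 < eps by rewrite lt_min m0 divr_gt0.
have epsm : eps <= m by rewrite ge_min lexx.
have epsD : eps * D <= c3 by rewrite -ler_pdivlMr// ge_min lexx orbT.
(* Asking for eps/2 instead of eps leaves a margin eps/2 b between u and the barrier beyond M. *)
have [M0 hM0] := hdecay (divr_gt0 eps0 (ltr0n _ 2)).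
pose M := Num.max 1 M0.
have M1 : 1 <= M by rewrite le_max lexx.
have hM z : M < enorm z -> u z <= eps / 2 * b z.
  by move=> Mz; apply: hM0; apply: le_lt_trans Mz; rewrite le_max lexx orbT.
(* The far cube has coordinates between M + 1 and M + 2. It avoids the ball of radius M + 1, hence a
   neighbourhood of every point where u is active. *)
pose a' (i : 'I_N) := M + 1.
pose rho' := N%:R * (M + 2).
have rho'1 : 1 <= rho'.
  have N1' : 1 <= N%:R :> R by rewrite ler1n.
  rewrite /rho'; nra.
have Srho' : open_cube a' 1 `<=` [set v | enorm v <= rho'].
  move=> z zS /=; apply: enorm_le_coord => [|i]; first by rewrite addr_ge0// (le_trans ler01).
  have := zS i; rewrite /= in_itv/= /a' => /andP[z1 z2].
  by rewrite ger0_norm; lra.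
have Sfar z : open_cube a' 1 z -> M + 1 < enorm z.
  move=> zS; have := zS (Ordinal N1); rewrite /= in_itv/= => /andP[z1 _].
  by apply: (lt_le_trans z1); apply: le_trans (ler_norm _) (coord_le_enorm _ _).
(* The least value of the margin eps/2 b allowed by |z| <= rho' on the far cube. *)
pose delta := eps / 2 * profile N s rho'.
have delta0 : 0 < delta by rewrite mulr_gt0 ?divr_gt0 ?profile_gt0.
have Sdelta z : open_cube a' 1 z -> u z + delta <= eps * b z.
  move=> zS; have uz : u z <= eps / 2 * b z.
    by apply: hM; apply: lt_trans (Sfar z zS); rewrite ltrDl.
  have dz : delta <= eps / 2 * b z.
    rewrite /delta ler_wpM2l ?divr_ge0 ?(ltW eps0)//.
    by apply: (profile_le s0 (enorm_ge0 z)); exact: Srho'.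
  by lra.
pose c5 := 2^-1 * profile N s M * (delta * lam * tail_const (N := N) s rho').
have t'0 : 0 < tail_const (N := N) s rho'.
  by apply: tail_const_gt0; exact: lt_le_trans rho'1.
have c50 : 0 < c5.
  by rewrite /c5 !mulr_gt0// ?profile_gt0.
(* With profile(r) <= 1/r this gives B kappa <= B eps / r <= c5; the quantities [M] and [c5] were
   fixed without reference to r. *)
pose r := M + 1 + B * eps / c5.
have Be0 : 0 <= B * eps by rewrite mulr_ge0 ?(ltW eps0).
have Mr : M + 1 <= r by rewrite lerDl divr_ge0 ?(ltW c50).
have r0 : 0 < r by lra.
pose kappa := eps * profile N s r.
have kappa0 : 0 < kappa by rewrite mulr_gt0 ?profile_gt0.
have kappam : kappa <= eps by rewrite ler_piMr ?(ltW eps0)// (profile_le1 s0 (ltW r0)).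
have Bkappa : B * kappa <= c5.
  rewrite /kappa mulrA; apply: (@le_trans _ _ (B * eps * r^-1)).
    by rewrite ler_wpM2l// (profile_le_inv s0 N1 r0).
  rewrite ler_pdivrMr// [leRHS]mulrC -ler_pdivrMr// /r; lra.
have kappa_le (z : rV) : enorm z < r -> kappa <= eps * b z.
  move=> zr; rewrite ler_wpM2l ?(ltW eps0)//.
  by apply: (profile_le s0 (enorm_ge0 z)); exact: ltW.
pose v := competitor eps kappa.
have cv : continuous v := @competitor_continuous eps kappa.
have v1 : L1_omega s v := competitor_L1 (ltW eps0) (ltW kappa0).
have vout z : ~ (enorm z < r) -> v z <= 0.
  move=> /negP; rewrite -leNgt => rz.
  have bz : eps * b z <= kappa.
    by rewrite ler_wpM2l ?(ltW eps0)// (profile_le s0 (ltW r0) rz).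
  rewrite /v /competitor subr_le0 ge_max bz andbT; apply: le_trans bz.
  have ub : u z <= eps / 2 * b z by apply: hM; lra.
  have := mulr_gt0 eps0 (b0 z); lra.
have vsub : viscosity_subsolution s I [set z | enorm z < r] V (cst 0) v.
  split; [exact: continuous_usc_on|exact: v1|].
  move=> x U psi oU Ux Ur psi1 psi2 psix vpsi; rewrite /cst.
  have xr : enorm x < r := Ur x Ux.
  have kx := kappa_le x xr.
  have eb0 := mulr_gt0 eps0 (b0 x).
  have VBx : - B <= V x <= B by rewrite -ler_norml.
  have /andP[VB1 VB2] := VBx.
  have [ub|ub] := leP (eps * b x) (u x).
    have vx : v x = u x - kappa by rewrite /v /competitor max_l.
    (* Beyond M one would have eps b <= u <= eps/2 b, impossible as b > 0. *)
    have xM : enorm x <= M.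
      by rewrite leNgt; apply/negP => /hM h; lra.
    pose U' := U `&` [set z | enorm z < M + 1].
    have oU' : open U'.
      apply: openI => //.
      rewrite (_ : [set _ | _] = @enorm R N @^-1` [set t | t < M + 1])//.
      by apply: open_comp => [z _|]; [exact: continuous_enorm|exact: open_lt].
    have U'x : U' x by split=> //=; lra.
    have psi2' : Ck_on 2 U' psi by apply: Ck_on_subset psi2 => // z [].
    have U'cube z : U' z -> ~ open_cube a' 1 z.
      by move=> [_ /= zM] /Sfar; rewrite ltNge (ltW zM).
    have := u_active oU' U'x psi2' psi1 U'cube (ltW kappa0) (ltW delta0) ler01 rho'1
      Srho' Sdelta vpsi (etrans psix vx).
    move=> /lee_test; apply; rewrite vx.
    have g5 : c5 <= gain s lam Lam x 0 delta 1 rho'.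
      rewrite /gain expr1n mulr1 !mul0r subr0 /c5; apply: ler_wpM2r.
        exact: (ltW (mulr_gt0 (mulr_gt0 delta0 lam0) t'0)).
      by rewrite ler_wpM2l// (profile_le s0 (enorm_ge0 x)).
    (* The terms in V u cancel: only V kappa remains, and it is at most c5. *)
    have : V x * kappa <= B * kappa by rewrite ler_wpM2r ?(ltW kappa0).
    lra.
  have vx : v x = eps * b x - kappa by rewrite /v /competitor max_r// ltW.
  have rpsi := pv_regular_C2 oU Ux psi2 psi1.
  have hS z : open_cube a l z -> eps * b z + m <= u z.
    move=> /cube_near /near_u h; have : eps * b z <= m.
      by rewrite (le_trans _ epsm)// ler_piMr ?(ltW eps0).
    lra.
  have := barrier_active rpsi (ltW eps0) (ltW m0) (ltW l0) rho1 Srho hS vpsi (etrans psix vx).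
  move=> /lee_test; apply; rewrite vx.
  have -> : gain s lam Lam x (eps * (2 + p)) m l rho = 2^-1 * b x * (c3 - eps * C1).
    by rewrite /gain /c3 /C1 /W; ring.
  (* Inside the ball 0 <= eps b - kappa <= eps b, so the zero-order term is again bounded by a
     multiple of b(x). *)
  have Vv : - (B * (eps * b x)) <= V x * (eps * b x - kappa).
    have h1 : - B * (eps * b x - kappa) <= V x * (eps * b x - kappa).
      by rewrite ler_wpM2r// subr_ge0.
    apply: le_trans h1; rewrite mulNr lerN2 ler_wpM2l//; lra.
  apply: le_trans (lerD (lexx _) Vv).
  have -> : 2^-1 * b x * (c3 - eps * C1) - B * (eps * b x) =
      2^-1 * b x * (c3 - eps * D + eps) by rewrite /D; field.
  by rewrite !mulr_ge0 ?invr_ge0 ?(ltW (b0 x))//; lra.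
have uscv := @continuous_usc_on R N (closure [set z | enorm z < r]) v cv.
(* The contradiction: the competitor at x0 is at least u(x0) - kappa >= 4 m - eps >= 3 m. *)
have := hmax r0 uscv v1 vsub vout x0.
have : u x0 - kappa <= v x0 by rewrite /v /competitor lerD2r le_max lexx.
have : u x0 = 4 * m by rewrite /m; field.
lra.
Qed.

End one_sided_bound.

(** For |x| >= 1 one has 1 + |x|^2 <= 2 |x|^2, hence |x|^(-p) <= 2^(p/2) b(x). The decay hypothesis
    is therefore used with e / 2^(p/2). *)
Lemma enorm_decay_barrier (R : realType) (N : nat) (s : R) (u : 'rV[R]_N -> R) : 0 < s ->
  (`|u x| * enorm x `^ (N%:R + 2 * s)) @[x --> enorm_pinfty R N] --> (0 : R) ->
  forall e, 0 < e -> exists M, forall x, M < enorm x -> `|u x| <= e * barrier s x.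
Proof.
move=> s0 hu e e0.
set p := N%:R + 2 * s in hu *.
have p0 : 0 < p by rewrite ltr_wpDl// mulr_gt0.
have e'0 : 0 < e / 2 `^ (p / 2) by rewrite divr_gt0// powR_gt0.
have [M _ hM] := hu _ (nbhsx_ballx (0 : R) _ e'0).
exists (Num.max 1 M) => x; rewrite gt_max => /andP[x1 /hM].
rewrite /= -ball_normE /ball_/= sub0r normrN normrM normr_id (ger0_norm (powR_ge0 _ _)) => ux.
have x0 : 0 < enorm x by exact: lt_trans x1.
have -> : e * barrier s x = e / 2 `^ (p / 2) * (2 `^ (p / 2) * barrier s x).
  by rewrite mulrA divfK// gt_eqF// powR_gt0.
have xp0 : 0 < enorm x `^ p by rewrite powR_gt0.
apply: (@le_trans _ _ (e / 2 `^ (p / 2) * (enorm x `^ p)^-1)).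
  by rewrite ler_pdivlMr// ltW.
rewrite ler_wpM2l ?(ltW e'0)//.
have Y0 : 0 < 1 + enorm x ^+ 2 by rewrite ltr_wpDr ?sqr_ge0.
rewrite /barrier /profile -/p powRN ler_pdivlMr ?powR_gt0// mulrC ler_pdivrMr//.
have -> : enorm x `^ p = (enorm x ^+ 2) `^ (p / 2).
  by rewrite -powR_mulrn ?(ltW x0)// -powRrM; congr (_ `^ _); field.
rewrite -powRM ?sqr_ge0//.
apply: ge0_ler_powR; rewrite ?nnegrE ?divr_ge0 ?(ltW p0) ?(ltW Y0)//.
  by rewrite mulr_ge0 ?sqr_ge0.
have : 1 <= enorm x ^+ 2 by rewrite exprn_ege1// ltW.
lra.
Qed.

Theorem theorem1 (R : realType) (N : nat) (s lam Lam : R)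
  (hN : (1 <= N)%N) (hs0 : 0 < s) (hs1 : s < 1)
  (hlam : 0 < lam) (hLam : lam <= Lam)
  (A : Type) (hA : inhabited A)
  (L : A -> ('rV[R]_N -> R) -> 'rV[R]_N -> \bar R)
  (hL : forall a, class_L s lam Lam (L a))
  (I : ('rV[R]_N -> R) -> 'rV[R]_N -> \bar R)
  (hI : (forall u x, I u x = ereal_sup [set L a u x | a in [set: A]]) \/
        (forall u x, I u x = ereal_inf [set L a u x | a in [set: A]]))
  (V : 'rV[R]_N -> R)
  (hVcont : continuous V) (hVbnd : bounded_fun V)
  (hmax : forall G : set 'rV[R]_N,
     bounded_C2_domain G -> maximum_principle s I V G)
  (hmin : forall G : set 'rV[R]_N,
     bounded_C2_domain G -> minimum_principle s I V G)
  (u : 'rV[R]_N -> R) (huL1 : L1_omega s u)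
  (hu : viscosity_solution s I [set: 'rV[R]_N] V (cst 0) u)
  (hdecay : (`|u x| * enorm x `^ (N%:R + 2 * s)) @[x --> enorm_pinfty R N]
     --> (0 : R)) :
  forall x, u x = 0.
Proof.
have Lam0 : 0 <= Lam by rewrite (le_trans _ hLam)// ltW.
have cmp : pv_comparison s lam Lam I.
  by case: hI => E; [exact: sup_pv_comparison hL _ E|exact: inf_pv_comparison hL _ E].
have [cu _ usub usup] := hu.
have cu' : continuous u.
  by move: cu => /(within_openP u openT) cu x; exact: cu.
have [B VB] : exists B, forall x, `|V x| <= B.
  (* [bounded_fun] only grants bounds strictly above B, hence B + 1. *)
  have [B [_ hB]] := hVbnd.
  by exists (B + 1) => x; apply: hB => //; rewrite ltrDl.
have decay e : 0 < e -> exists M, forall x, M < enorm x -> `|u x| <= e * barrier s x.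
  exact: enorm_decay_barrier.
move=> x; apply/eqP; rewrite eq_le; apply/andP; split.
  apply: (@viscosity_subsolution_le0 R N s lam Lam hs0 hs1 hlam Lam0 hN I V u B cmp VB) => //.
  - by move=> r r0; apply: hmax; exact: bounded_C2_domain_ball.
  - move=> e /decay[M hM]; exists M => z /hM; apply: le_trans; exact: ler_norm.
rewrite -oppr_le0.
apply: (@viscosity_subsolution_le0 R N s lam Lam hs0 hs1 hlam Lam0 hN (dual_operator I) V (\- u) B
  (pv_comparisonN hs0 hs1 cmp) VB).
- by move=> r r0; apply: minimum_principle_dual; apply: hmin; exact: bounded_C2_domain_ball.
- by move=> z; apply: continuousN; exact: cu'.
- exact: L1_omegaN.
- exact: supersolution_dual.
- move=> e /decay[M hM]; exists M => z /hM; apply: le_trans => /=; rewrite -normrN; exact: ler_norm.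
Qed.
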